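(* For every $N \in \mathbb{N}$ there exists a right-angled Artin group $A_\Gamma$ such that $|\mathrm{Out}(\mathrm{Aut}(A_\Gamma))| > N$. Moreover, $A_\Gamma$ can be chosen to have trivial centre, and it can also be chosen to have non-trivial centre.
   Context: For a finite simplicial graph $\Gamma=(V,E)$, the right-angled Artin group $A_\Gamma$ is the group with presentation $\langle v\in V \mid [v,w]=1 \text{ whenever } (v,w)\in E\rangle$. For a group $G$, $\mathrm{Out}(G)=\mathrm{Aut}(G)/\mathrm{Inn}(G)$. *)

(* Defs.v *)
From mathcomp Require Import all_boot.
From Stdlib Require Import ClassicalEpsilon FunctionalExtensionality
  PropExtensionality ProofIrrelevance.

Set Implicit Arguments.
Unset Strict Implicit.
Unset Printing Implicit Defensive.

Record Grp := MkGrp {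
  gcarrier :> Type;
  gmul : gcarrier -> gcarrier -> gcarrier;
  gone : gcarrier;
  ginv : gcarrier -> gcarrier;
  gmulA : forall x y z, gmul x (gmul y z) = gmul (gmul x y) z;
  gmul1 : forall x, gmul gone x = x;
  gmulV : forall x, gmul (ginv x) x = gone }.

(* An automorphism: a bijective homomorphism (the inverse map is stored;
   it is uniquely determined by the forward map, see aut_ext). *)
Record automorphism (G : Grp) := Automorphism {
  afun :> G -> G;
  ainv : G -> G;
  afunM : forall x y, afun (gmul x y) = gmul (afun x) (afun y);
  afunK : cancel afun ainv;
  ainvK : cancel ainv afun }.

Lemma aut_ext (G : Grp) (f g : automorphism G) : afun f =1 afun g -> f = g.
Proof.
destruct f as [f f' fM fK f'K]; destruct g as [g g' gM gK g'K]; simpl => H.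
have Hfg : f = g by apply: functional_extensionality.
subst g.
have Hf' : f' = g'.
  apply: functional_extensionality => x.
  by rewrite -[in RHS](f'K x) gK.
subst g'; f_equal; apply: proof_irrelevance.
Qed.

Section AutGroup.
Variable G : Grp.

Lemma aut_mulM (f g : automorphism G) x y :
  f (g (gmul x y)) = gmul (f (g x)) (f (g y)).
Proof. by rewrite !afunM. Qed.
Lemma aut_mulK (f g : automorphism G) :
  cancel (fun x => f (g x)) (fun x => ainv g (ainv f x)).
Proof. by move=> x; rewrite !afunK. Qed.
Lemma aut_mulVK (f g : automorphism G) :
  cancel (fun x => ainv g (ainv f x)) (fun x => f (g x)).
Proof. by move=> x; rewrite !ainvK. Qed.

Definition aut_mul (f g : automorphism G) : automorphism G :=
  @Automorphism G _ _ (aut_mulM f g) (aut_mulK f g) (aut_mulVK f g).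

Definition aut_one : automorphism G :=
  @Automorphism G id id (fun _ _ => erefl) (fun _ => erefl) (fun _ => erefl).

Lemma aut_invM (f : automorphism G) x y :
  ainv f (gmul x y) = gmul (ainv f x) (ainv f y).
Proof. by rewrite -{1}(ainvK f x) -{1}(ainvK f y) -afunM afunK. Qed.

Definition aut_inv (f : automorphism G) : automorphism G :=
  @Automorphism G _ _ (aut_invM f) (ainvK f) (afunK f).

Lemma aut_mulA (f g h : automorphism G) :
  aut_mul f (aut_mul g h) = aut_mul (aut_mul f g) h.
Proof. by apply: aut_ext. Qed.
Lemma aut_mul1 (f : automorphism G) : aut_mul aut_one f = f.
Proof. by apply: aut_ext. Qed.
Lemma aut_mulV (f : automorphism G) : aut_mul (aut_inv f) f = aut_one.
Proof. by apply: aut_ext => x /=; rewrite afunK. Qed.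

End AutGroup.

Definition Aut (G : Grp) : Grp :=
  @MkGrp (automorphism G) (@aut_mul G) (aut_one G) (@aut_inv G)
    (@aut_mulA G) (@aut_mul1 G) (@aut_mulV G).

Definition inner (G : Grp) (f : automorphism G) : Prop :=
  exists h : G, forall x, f x = gmul h (gmul x (ginv h)).

(* |Out(G)| > N : there are N+1 automorphisms lying in pairwise distinct
   cosets of Inn(G) in Aut(G). *)
Definition out_card_gt (G : Grp) (N : nat) : Prop :=
  exists phi : 'I_N.+1 -> automorphism G,
    forall i j, i != j -> ~ inner (aut_mul (phi i) (aut_inv (phi j))).

Definition trivial_centre (G : Grp) : Prop :=
  forall z : G, (forall g : G, gmul z g = gmul g z) -> z = gone G.

(* Right-angled Artin group of a graph (T, e), via its presentation:     *)
(* words in the letters v^{+1} = (v,true), v^{-1} = (v,false), modulo    *)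
(* the congruence generated by x x^{-1} = 1 and the relators            *)
(* v w v^{-1} w^{-1} = 1 for every edge e v w.                           *)
Section RAAG.
Variables (T : finType) (e : rel T).

Definition word := seq (T * bool).

Inductive raag_rel : word -> word -> Prop :=
| rr_refl w : raag_rel w w
| rr_sym u v : raag_rel u v -> raag_rel v u
| rr_trans u v w : raag_rel u v -> raag_rel v w -> raag_rel u w
| rr_ctx a b u v : raag_rel u v -> raag_rel (a ++ u ++ b) (a ++ v ++ b)
| rr_free x s : raag_rel [:: (x, s); (x, ~~ s)] [::]
| rr_comm v w : e v w ->
    raag_rel [:: (v, true); (w, true); (v, false); (w, false)] [::].

Definition raag_carrier := {P : word -> Prop | exists w, P = raag_rel w}.

Definition cls (w : word) : raag_carrier :=
  exist _ (raag_rel w) (ex_intro _ w erefl).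

Definition rep (q : raag_carrier) : word :=
  proj1_sig (constructive_indefinite_description _ (proj2_sig q)).

Lemma repP q : proj1_sig q = raag_rel (rep q).
Proof. exact: (proj2_sig (constructive_indefinite_description _ (proj2_sig q))). Qed.

Lemma clsE w1 w2 : raag_rel w1 w2 -> cls w1 = cls w2.
Proof.
move=> H; apply: subset_eq_compat.
apply: functional_extensionality => u; apply: propositional_extensionality.
split=> H'; [exact: rr_trans (rr_sym H) H' | exact: rr_trans H H'].
Qed.

Lemma clsK q : cls (rep q) = q.
Proof.
have := repP q; destruct q as [P HP] => /= HPq.
by apply: subset_eq_compat; symmetry; exact: HPq.
Qed.

Lemma rep_cls w : raag_rel (rep (cls w)) w.
Proof.
have H := repP (cls w); simpl in H.
apply: rr_sym; rewrite H; exact: rr_refl.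
Qed.

Lemma rr_cat u u' v v' :
  raag_rel u u' -> raag_rel v v' -> raag_rel (u ++ v) (u' ++ v').
Proof.
move=> Hu Hv; apply: rr_trans (rr_ctx [::] v Hu) _ => /=.
have := rr_ctx u' [::] Hv; rewrite !cats0; exact.
Qed.

Definition winv (w : word) : word := rev (map (fun p => (p.1, ~~ p.2)) w).

Lemma winvK_rel w : raag_rel (winv w ++ w) [::].
Proof.
elim: w => [|[x s] w IH]; first exact: rr_refl.
rewrite /winv map_cons rev_cons -/(winv w) cat_rcons.
apply: rr_trans IH.
have := rr_ctx (winv w) w (rr_free x (~~ s)).
by rewrite negbK /=.
Qed.

Definition raag_mul (p q : raag_carrier) := cls (rep p ++ rep q).
Definition raag_one := cls [::].
Definition raag_inv (p : raag_carrier) := cls (winv (rep p)).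

Lemma raag_mulA x y z :
  raag_mul x (raag_mul y z) = raag_mul (raag_mul x y) z.
Proof.
apply: clsE.
apply: rr_trans (rr_cat (rr_refl (rep x)) (rep_cls _)) _.
apply: rr_trans (rr_sym (rr_cat (rep_cls _) (rr_refl (rep z)))).
rewrite catA; exact: rr_refl.
Qed.

Lemma raag_mul1 x : raag_mul raag_one x = x.
Proof.
rewrite -[RHS]clsK; apply: clsE.
exact: (rr_cat (rep_cls [::]) (rr_refl _)).
Qed.

Lemma raag_mulV x : raag_mul (raag_inv x) x = raag_one.
Proof.
apply: clsE; apply: rr_trans (winvK_rel (rep x)).
exact: rr_cat (rep_cls _) (rr_refl _).
Qed.

Definition raag : Grp :=
  @MkGrp raag_carrier raag_mul raag_one raag_inv raag_mulA raag_mul1 raag_mulV.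

End RAAG.

Definition simplicial {n : nat} (e : rel 'I_n) : Prop :=
  symmetric e /\ irreflexive e.

(* Main.v *)
(** Take [A = (B_0 x ... x B_{N+1}) * (Z x F_2)] with [B_i] free of rank
    [i + 2]. Centralizers in free products show that every automorphism of [A]
    maps both free factors to conjugates of themselves, hence is [ad a \o psi]
    with [a] unique and [psi] preserving the two free factors; a Krull-Schmidt
    argument shows that [psi] also preserves each [B_i]. So
    [Aut A] is the semidirect product of [Inn A = A] and
    [Aut B_0 x ... x Aut B_{N+1} x Aut (Z x F_2)]. An element [b] of [B_i]
    gives two elements of [Aut A], the conjugation by [b] and the partial
    conjugation by [b] of the second free factor alone, and for each [i] there
    is an involution of [Aut A] exchanging the former with the inverse of the
    latter while fixing the [psi]'s. It moves [Inn B_i] out of [Inn A] and fixes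
    [Inn B_j] for [j <> i], so these involutions represent distinct elements of
    [Out (Aut A)].

    They do not change the action of an automorphism on homomorphisms from [A]
    to abelian groups, so they extend to [Aut (Z x A)], whose elements are
    [(z, a) |-> (c (z, a), phi a)]; this settles the case of a non-trivial
    centre. *)

(* Both free factors have to be recognisable inside [A] by commutation alone. Each has enough
   commuting elements to land in a conjugate of a free factor under any embedding into [A]: the
   first because it has at least two blocks, the second because of its central [Z]. The same [Z]
   prevents an automorphism from exchanging the factors, since the first has trivial centre. In the
   Krull-Schmidt step no chain condition is used: commutative transitivity of free groups shows that
   a block cannot spread over two blocks, and distinct ranks rule out a permutation.

   The inversion in the exchange is forced. For [b] in [B_i], let [p] be the partial conjugation by
   [b] of the second free factor. Conjugation by [b] composed with the inverse of [p] conjugates the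
   first factor alone; it is one of the [psi] and must be fixed, whereas exchanging conjugation by
   [b] with [p] itself would invert it. *)
Require Import Defs.
From mathcomp Require Import all_boot.
From mathcomp Require Import boolp.

Set Implicit Arguments.
Unset Strict Implicit.
Unset Printing Implicit Defensive.

Arguments gmul : simpl never.
Arguments ginv : simpl never.
Arguments gone : simpl never.

Declare Scope grp_scope.
Delimit Scope grp_scope with grp.
Local Notation "x * y" := (gmul x y) : grp_scope.
Local Notation "x ^-1" := (ginv x) : grp_scope.
Local Notation "1" := (gone _) : grp_scope.
Local Open Scope grp_scope.

(** * Elementary group theory over the record [Grp] *)

Section GroupBasics.
Variable G : Grp.
Implicit Types x y z : G.

Lemma mulKg x y : x^-1 * (x * y) = y.
Proof. by rewrite gmulA gmulV gmul1. Qed.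

Lemma mulgI x y z : x * y = x * z -> y = z.
Proof. by move=> e; rewrite -(mulKg x y) e mulKg. Qed.

Lemma mulg1 x : x * 1 = x.
Proof. by apply: (@mulgI x^-1); rewrite mulKg gmulV. Qed.

Lemma mulgV x : x * x^-1 = 1.
Proof. by apply: (@mulgI x^-1); rewrite mulKg mulg1. Qed.

Lemma mulKVg x y : x * (x^-1 * y) = y.
Proof. by rewrite gmulA mulgV gmul1. Qed.

Lemma mulgK x y : y * x * x^-1 = y.
Proof. by rewrite -gmulA mulgV mulg1. Qed.

Lemma mulgKV x y : y * x^-1 * x = y.
Proof. by rewrite -gmulA gmulV mulg1. Qed.

Lemma mulIg x y z : y * x = z * x -> y = z.
Proof. by move=> e; rewrite -(mulgK x y) e mulgK. Qed.

Lemma invg_uniq x y : x * y = 1 -> y = x^-1.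
Proof. by move=> e; apply: (@mulgI x); rewrite e mulgV. Qed.

Lemma invgK x : x^-1^-1 = x.
Proof. by symmetry; apply: invg_uniq; rewrite gmulV. Qed.

Lemma invg1 : (1 : G)^-1 = 1.
Proof. by symmetry; apply: invg_uniq; rewrite gmul1. Qed.

Lemma invMg x y : (x * y)^-1 = y^-1 * x^-1.
Proof. by symmetry; apply: invg_uniq; rewrite gmulA mulgK mulgV. Qed.

Lemma invg_eq1 x : x^-1 = 1 -> x = 1.
Proof. by move=> e; rewrite -(invgK x) e invg1. Qed.

Definition commute x y := x * y = y * x.

Lemma commute_sym x y : commute x y -> commute y x.
Proof. by rewrite /commute => ->. Qed.

Lemma commute1 x : commute x 1.
Proof. by rewrite /commute gmul1 mulg1. Qed.

Lemma commuteV x y : commute x y -> commute x y^-1.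
Proof.
rewrite /commute => e; apply: (@mulgI y); apply: (@mulIg y).
by rewrite mulKVg -(gmulA y) mulgKV e.
Qed.

Lemma commuteM x y z : commute x y -> commute x z -> commute x (y * z).
Proof. by rewrite /commute => e e'; rewrite gmulA e -gmulA e' gmulA. Qed.

Definition conjg a x : G := a * x * a^-1.

Lemma conjgM a x y : conjg a (x * y) = conjg a x * conjg a y.
Proof. by rewrite /conjg !gmulA mulgKV. Qed.

Lemma conj1g x : conjg 1 x = x.
Proof. by rewrite /conjg invg1 mulg1 gmul1. Qed.

Lemma conjMg a b x : conjg (a * b) x = conjg a (conjg b x).
Proof. by rewrite /conjg invMg !gmulA. Qed.

Lemma conjgK a : cancel (conjg a) (conjg a^-1).
Proof. by move=> x; rewrite -conjMg gmulV conj1g. Qed.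

Lemma conjgKV a : cancel (conjg a^-1) (conjg a).
Proof. by move=> x; rewrite -conjMg mulgV conj1g. Qed.

Lemma conjg_fix a x : commute a x -> conjg a x = x.
Proof. by rewrite /conjg => ->; rewrite mulgK. Qed.

Lemma fix_conjg a x : conjg a x = x -> commute a x.
Proof. by move=> e; apply: (@mulIg a^-1); rewrite mulgK. Qed.

Definition ad a : automorphism G :=
  Automorphism (conjgM a) (conjgK a) (conjgKV a).

Lemma adM a b : ad (a * b) = aut_mul (ad a) (ad b).
Proof. by apply: aut_ext => x /=; rewrite conjMg. Qed.

End GroupBasics.

Definition is_hom (G H : Grp) (f : G -> H) := forall x y, f (x * y) = f x * f y.

Section Homs.
Variables (G H : Grp) (f : G -> H).
Hypothesis fM : is_hom f.

Lemma hom1 : f 1 = 1.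
Proof. by apply: (@mulgI _ (f 1)); rewrite -fM !mulg1. Qed.

Lemma homV x : f x^-1 = (f x)^-1.
Proof. by apply: invg_uniq; rewrite -fM mulgV hom1. Qed.

Lemma hom_conjg a x : f (conjg a x) = conjg (f a) (f x).
Proof. by rewrite /conjg !fM homV. Qed.

Lemma hom_commute x y : commute x y -> commute (f x) (f y).
Proof. by rewrite /commute -!fM => ->. Qed.

Lemma inj_commute x y : injective f -> commute (f x) (f y) -> commute x y.
Proof. by rewrite /commute -!fM => fI /fI. Qed.

End Homs.

Lemma is_hom_comp (G H K : Grp) (f : H -> K) (g : G -> H) :
  is_hom f -> is_hom g -> is_hom (f \o g).
Proof. by move=> fM gM x y /=; rewrite gM fM. Qed.

Lemma is_hom_aut (G : Grp) (f : automorphism G) : is_hom f.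
Proof. exact: afunM. Qed.

Lemma aut_inj (G : Grp) (f : automorphism G) : injective f.
Proof. exact: can_inj (afunK f). Qed.

Section ProductGroup.
Variables G H : Grp.
Implicit Types p q r : (G * H)%type.

Definition pmul p q : (G * H)%type := (p.1 * q.1, p.2 * q.2).
Definition pinv p : (G * H)%type := (p.1^-1, p.2^-1).
Lemma pmulA p q r : pmul p (pmul q r) = pmul (pmul p q) r.
Proof. by rewrite /pmul /= !gmulA. Qed.
Lemma pmul1 p : pmul (1, 1) p = p.
Proof. by case: p => x y; rewrite /pmul /= !gmul1. Qed.
Lemma pmulV p : pmul (pinv p) p = (1, 1).
Proof. by rewrite /pmul /= !gmulV. Qed.

Definition prodg : Grp := MkGrp pmulA pmul1 pmulV.

End ProductGroup.

(** * Free products *)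

Section FreeProduct.
Variables G1 G2 : Grp.
Local Notation K := (prodg G1 G2).

(* The two factors are encoded as subgroups of the direct product, so that
   letters of both sides live in a single group. *)
Definition side (b : bool) (k : K) : Prop := if b then k.2 = 1 else k.1 = 1.

Lemma side1 b : side b 1. Proof. by case: b. Qed.
Lemma sideM b x y : side b x -> side b y -> side b (x * y).
Proof. by case: b; rewrite /side /= => -> ->; rewrite gmul1. Qed.
Lemma sideV b x : side b x -> side b x^-1.
Proof. by case: b; rewrite /side /= => ->; rewrite invg1. Qed.

Definition letter := (bool * K)%type.
Implicit Types (l : letter) (u v w : seq letter) (b : bool) (x y z : K).

Definition good l : bool := `[< side l.1 l.2 /\ l.2 <> 1 >].
Definition alt l l' : bool := l.1 != l'.1.
Definition red u : bool := all good u && sorted alt u.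
Definition headside u : option bool := ohead (map fst u).
Definition lastside u : option bool := headside (rev u).
Definition linv l : letter := (l.1, l.2^-1).
Definition winvl u := rev (map linv u).

Lemma red_cons l u :
  red (l :: u) = [&& good l, headside u != Some l.1 & red u].
Proof.
rewrite /red /=; case: u => [|l' u] /=; first by rewrite !andbT.
rewrite /alt (inj_eq (@Some_inj _)) [l'.1 == _]eq_sym.
by case: (good l); case: (good l'); case: (all _ _); case: (_ == _).
Qed.

Lemma red_rev u : red (rev u) = red u.
Proof.
rewrite /red all_rev rev_sorted; congr andb.
by case: u => //= a u; apply: eq_path => p q; rewrite /alt eq_sym.
Qed.

Lemma headside_cat u v : headside (u ++ v) = if u is [::] then headside v else headside u.
Proof. by case: u. Qed.

Lemma lastside_cat u v : lastside (u ++ v) = if v is [::] then lastside u else lastside v.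
Proof.
rewrite /lastside rev_cat headside_cat; case: v => //= l v.
by rewrite rev_cons; case: (rev v).
Qed.

Definition junction u v := (lastside u == None) || (lastside u != headside v).

Lemma red_cat u v : red (u ++ v) = [&& red u, red v & junction u v].
Proof.
rewrite /junction; elim: u => [|l u IH]; first by rewrite andbT.
rewrite cat_cons !red_cons IH headside_cat -cat1s lastside_cat.
case: u {IH} => [|l' u] /=; last by rewrite -!andbA.
rewrite /lastside /= [Some l.1 == _]eq_sym.
by case: (good l); rewrite //= andbT andbC.
Qed.

Lemma good_linv l : good (linv l) = good l.
Proof.
apply/asboolP/asboolP => -[/= h n]; split.
- by rewrite -(invgK l.2); apply: sideV.
- by move=> e; apply: n; rewrite e invg1.
- exact: sideV.
- by move=> e; apply: n; apply: (@invg_eq1 K).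
Qed.

Lemma headside_map u : headside (map linv u) = headside u.
Proof. by case: u. Qed.

Lemma red_winvl u : red (winvl u) = red u.
Proof.
rewrite /winvl red_rev; elim: u => //= l u IH.
by rewrite !red_cons IH good_linv headside_map.
Qed.

Lemma headside_winvl u : headside (winvl u) = lastside u.
Proof. by rewrite /winvl -map_rev headside_map. Qed.

Lemma lastside_winvl u : lastside (winvl u) = headside u.
Proof. by rewrite /lastside /winvl revK headside_map. Qed.

Definition consl b x w := if `[< x = 1 >] then w else (b, x) :: w.

(* [w] read as [x * w'] with [x] in side [b] and [w'] not starting in [b]. *)
Definition split b w : K * seq letter :=
  if w is l :: w' then if l.1 == b then (l.2, w') else (1, w) else (1, w).

(** Van der Waerden's method: a single letter acts on reduced words by left multiplication, and
    [mulw] composes these actions, so that the group laws reduce to the action law [pushM]. *)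
Definition push b x w := consl b (x * (split b w).1) (split b w).2.
Definition mulw u v := foldr (fun l w => push l.1 l.2 w) v u.

Lemma consl_split b w : red w -> consl b (split b w).1 (split b w).2 = w.
Proof.
case: w => [|[c x] w]; first by rewrite /consl asboolT.
rewrite red_cons /= => /andP[/asboolP[_ n] _]; case: eqP => /= [<-|_].
  by rewrite /consl asboolF.
by rewrite /consl asboolT.
Qed.

Lemma red_split b w : red w ->
  [/\ side b (split b w).1, red (split b w).2 & headside (split b w).2 != Some b].
Proof.
case: w => [|[c x] w]; first by move=> _; split=> //; apply: side1.
move=> r; have := r; rewrite red_cons /= => /and3P[/asboolP[/= h n] hd rw].
case: (c =P b) hd => /= [e hd|ne _]; first by rewrite -e.
by split=> //; [apply: side1 | apply/eqP => -[]].
Qed.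

Lemma red_consl b x w : side b x -> red w -> headside w != Some b ->
  red (consl b x w).
Proof.
move=> h r hd; rewrite /consl; case: asboolP => // n.
by rewrite red_cons /= hd r !andbT; apply/asboolP.
Qed.

Lemma split_consl b x w : headside w != Some b -> split b (consl b x w) = (x, w).
Proof.
rewrite /consl; case: asboolP => [->|_] /=; last by rewrite eqxx.
by case: w => //= l w; rewrite (inj_eq (@Some_inj _)) => /negPf->.
Qed.

Lemma red_push b x w : side b x -> red w -> red (push b x w).
Proof.
by move=> h /(@red_split b)[h1 h2 h3]; apply: red_consl => //; apply: sideM.
Qed.

Lemma push1 b w : red w -> push b 1 w = w.
Proof. by move=> r; rewrite /push gmul1 consl_split. Qed.

Lemma pushM b x y w : red w -> push b x (push b y w) = push b (x * y) w.
Proof.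
move=> /(@red_split b)[_ _ h]; rewrite {1 2}/push.
by rewrite split_consl //= gmulA.
Qed.

Lemma push_red l w : red (l :: w) -> push l.1 l.2 w = l :: w.
Proof.
rewrite red_cons => /and3P[/asboolP[_ n] hd rw].
have -> : w = consl l.1 1 w by rewrite /consl asboolT.
rewrite /push split_consl //= mulg1 /consl asboolF // asboolT //.
by rewrite -surjective_pairing.
Qed.

Lemma red_mulw u v : all good u -> red v -> red (mulw u v).
Proof.
elim: u => //= l u IH /andP[/asboolP[h _] gu] rv.
by apply: red_push => //; apply: IH.
Qed.

Lemma red_good u : red u -> all good u. Proof. by case/andP. Qed.

(** The heart of associativity. Splitting off the initial [b]-part of [u], both sides become one
    push of the product of [x] with that part, by [pushM]. *)
Lemma mulw_push b x u v : side b x -> red u -> red v ->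
  mulw (push b x u) v = push b x (mulw u v).
Proof.
move=> hx ru rv.
have C y w : red w -> mulw (consl b y w) v = push b y (mulw w v).
  move=> rw; rewrite /consl; case: asboolP => [->|//].
  by rewrite push1 //; apply: red_mulw => //; apply: red_good.
have [hs rs _] := @red_split b _ ru.
have rm := red_mulw (red_good rs) rv.
by rewrite {1}/push C // -pushM // -C // consl_split.
Qed.

Lemma mulwA u v w : red u -> red v -> red w ->
  mulw (mulw u v) w = mulw u (mulw v w).
Proof.
move=> ru rv rw; elim: u ru => //= l u IH.
rewrite red_cons => /and3P[/asboolP[h _] _ ru].
by rewrite mulw_push ?IH //; apply: red_mulw => //; apply: red_good.
Qed.

Lemma mulw_cat u v : red (u ++ v) -> mulw u v = u ++ v.
Proof.
elim: u => //= l u IH r.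
rewrite IH; first exact: push_red.
by move: r; rewrite red_cons => /and3P[].
Qed.

Lemma mulw_winvl u : red u -> mulw (winvl u) u = [::].
Proof.
elim: u => //= l u IH r.
rewrite /winvl /= rev_cons -cats1 /mulw foldr_cat /= -/(mulw _ _) -/(winvl u).
have ru : red u by move: r; rewrite red_cons => /and3P[].
by rewrite -(push_red r) pushM // gmulV push1 // IH.
Qed.

Definition fp_carrier := {u : seq letter | red u}.
Implicit Types p q r : fp_carrier.

Lemma fp_red p : red (sval p). Proof. by case: p. Qed.

Lemma fp_inj p q : sval p = sval q -> p = q.
Proof. by case: p q => [u ru] [v rv] /= e; exact: eq_exist. Qed.

Definition fp_mul p q : fp_carrier :=
  exist (fun u => is_true (red u)) (mulw (sval p) (sval q))
    (red_mulw (red_good (fp_red p)) (fp_red q)).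
Definition fp_one : fp_carrier := exist (fun u => is_true (red u)) [::] isT.
Lemma fp_inv_subproof p : red (winvl (sval p)).
Proof. by rewrite red_winvl (fp_red p). Qed.
Definition fp_inv p : fp_carrier :=
  exist (fun u => is_true (red u)) (winvl (sval p)) (fp_inv_subproof p).
Lemma fp_mulA p q r : fp_mul p (fp_mul q r) = fp_mul (fp_mul p q) r.
Proof. by apply: fp_inj; rewrite /= mulwA //; apply: fp_red. Qed.
Lemma fp_mul1 p : fp_mul fp_one p = p.
Proof. exact: fp_inj. Qed.
Lemma fp_mulV p : fp_mul (fp_inv p) p = fp_one.
Proof. by apply: fp_inj; apply: mulw_winvl (fp_red p). Qed.

Definition freeprod : Grp := MkGrp fp_mulA fp_mul1 fp_mulV.

End FreeProduct.

(** The universal property is stated with existence only; uniqueness is replaced by generation, in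
    the form of an induction principle. *)
Definition coproduct (G1 G2 A : Grp) (e1 : G1 -> A) (e2 : G2 -> A) : Prop :=
  [/\ is_hom e1, is_hom e2,
      forall (H : Grp) (f1 : G1 -> H) (f2 : G2 -> H), is_hom f1 -> is_hom f2 ->
        exists F : A -> H, [/\ is_hom F, F \o e1 =1 f1 & F \o e2 =1 f2]
    & forall P : A -> Prop, (forall x, P (e1 x)) -> (forall y, P (e2 y)) ->
        (forall a c, P a -> P c -> P (a * c)) -> forall a, P a].

(** * Normal forms in a free product, its universal property, malnormality of the factors *)

Section FreeProductTheory.
Variables G1 G2 : Grp.
Local Notation K := (prodg G1 G2).
Local Notation A := (freeprod G1 G2).
Implicit Types (b : bool) (k : K) (a c x y z g h : A) (u v w : seq (letter G1 G2)).

Definition lst a : seq (letter G1 G2) := sval a.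

Arguments lst : simpl never.

Lemma lst_red a : red (lst a). Proof. exact: fp_red. Qed.

Lemma lst_inj : injective lst. Proof. exact: fp_inj. Qed.

Lemma lstM a c : lst (a * c) = mulw (lst a) (lst c). Proof. by []. Qed.

Lemma lstV a : lst a^-1 = winvl (lst a). Proof. by []. Qed.

Lemma lst1 : lst 1 = [::]. Proof. by []. Qed.

Definition mkfp u (r : red u) : A := exist (fun u => is_true (red u)) u r.

Lemma lst_mkfp u (r : red u) : lst (mkfp r) = u. Proof. by []. Qed.

Lemma lstM_cat a c : red (lst a ++ lst c) -> lst (a * c) = lst a ++ lst c.
Proof. exact: mulw_cat. Qed.

Definition hs a := headside (lst a).
Definition ls a := lastside (lst a).

Lemma hsV a : hs a^-1 = ls a. Proof. exact: headside_winvl. Qed.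

Lemma lsV a : ls a^-1 = hs a. Proof. exact: lastside_winvl. Qed.

Lemma size_lstV a : size (lst a^-1) = size (lst a).
Proof. by rewrite lstV size_rev size_map. Qed.

Lemma hs_None a : hs a = None -> a = 1.
Proof. by rewrite /hs => e; apply: lst_inj; case: (lst a) e. Qed.

Lemma ls_None a : ls a = None -> a = 1.
Proof. by rewrite -hsV => /hs_None/invg_eq1. Qed.

Lemma red_consl_nil b k : side b k -> red (consl b k [::]).
Proof. by move=> h; apply: red_consl. Qed.

(** Made total by the default value 1 off the side [b], so that letters can be embedded without
    carrying a proof. *)
Definition emb b k : A :=
  if pselect (side b k) is left h then mkfp (red_consl_nil h) else 1.

Lemma lst_emb b k : side b k -> lst (emb b k) = consl b k [::].
Proof. by rewrite /emb; case: pselect. Qed.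

Lemma push_consl b k w : red w -> headside w != Some b -> push b k w = consl b k w.
Proof.
move=> r hd; have e : w = consl b 1 w by rewrite /consl asboolT.
by rewrite {1}e /push split_consl //= mulg1.
Qed.

Lemma lst_embM b k a : side b k -> lst (emb b k * a) = push b k (lst a).
Proof.
move=> h; rewrite lstM lst_emb // /consl; case: asboolP => // ->.
by rewrite push1 ?lst_red.
Qed.

Lemma lst_embM_cons b k a : side b k -> k <> 1 -> hs a != Some b ->
  lst (emb b k * a) = (b, k) :: lst a.
Proof.
move=> h n hd; rewrite lst_embM // push_consl ?lst_red //.
by rewrite /consl asboolF.
Qed.

Lemma embM b k k' : side b k -> side b k' -> emb b (k * k') = emb b k * emb b k'.
Proof.
move=> h h'; apply: lst_inj; rewrite lst_embM // !lst_emb //; last exact: sideM.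
rewrite -[consl b k' _]push_consl // pushM // push_consl //.
Qed.

Lemma emb_inj b k k' : side b k -> side b k' -> emb b k = emb b k' -> k = k'.
Proof.
move=> h h' /(congr1 lst); rewrite !lst_emb // /consl.
by case: asboolP => [->|_]; case: asboolP => [->|_] // [].
Qed.

Lemma emb1 b : emb b 1 = 1.
Proof. by apply: lst_inj; rewrite lst_emb ?/consl ?asboolT //; apply: side1. Qed.

Lemma fp_ind (P : A -> Prop) :
  P 1 ->
  (forall b k a, side b k -> k <> 1 -> hs a != Some b -> P a -> P (emb b k * a)) ->
  forall a, P a.
Proof.
move=> P1 PS a; move: {2}(lst a) (erefl (lst a)) => u.
elim: u a => [|[b k] u IH] a e; first by rewrite (lst_inj (e : lst a = lst 1)).
have := lst_red a; rewrite e red_cons /= => /and3P[/asboolP[/= h n] hd r].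
suff -> : a = emb b k * mkfp r by apply: PS => //; apply: IH.
by apply: lst_inj; rewrite lst_embM_cons.
Qed.

Definition in1 (x : G1) : A := emb true ((x, 1) : K).
Definition in2 (x : G2) : A := emb false ((1, x) : K).

Lemma in1_hom : is_hom in1.
Proof.
move=> x y; rewrite /in1 -embM //; congr emb.
by congr pair; rewrite gmul1.
Qed.

Lemma in2_hom : is_hom in2.
Proof.
move=> x y; rewrite /in2 -embM //; congr emb.
by congr pair; rewrite gmul1.
Qed.

Lemma in1_inj : injective in1.
Proof. by move=> x y /(@emb_inj true (x, 1) (y, 1) erefl erefl)[]. Qed.

Lemma in2_inj : injective in2.
Proof. by move=> x y /(@emb_inj false (1, x) (1, y) erefl erefl)[]. Qed.

Lemma emb_true k : side true k -> emb true k = in1 k.1.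
Proof. by case: k => x y /= ->. Qed.

Lemma emb_false k : side false k -> emb false k = in2 k.2.
Proof. by case: k => x y /= ->. Qed.

Section Universal.
Variables (H : Grp) (f1 : G1 -> H) (f2 : G2 -> H).
Hypotheses (f1M : is_hom f1) (f2M : is_hom f2).

Definition letter_val b k : H := if b then f1 k.1 else f2 k.2.
Definition word_val u : H := foldr (fun l (t : H) => letter_val l.1 l.2 * t) 1 u.

Lemma letter_valM b k k' :
  letter_val b (k * k') = letter_val b k * letter_val b k'.
Proof. by case: b; [apply: f1M | apply: f2M]. Qed.

Lemma letter_val1 b : letter_val b 1 = 1.
Proof. by case: b; [apply: (hom1 f1M) | apply: (hom1 f2M)]. Qed.

Lemma word_val_consl b k w : word_val (consl b k w) = letter_val b k * word_val w.
Proof.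
by rewrite /consl; case: asboolP => // ->; rewrite letter_val1 gmul1.
Qed.

Lemma word_val_push b k w : red w ->
  word_val (push b k w) = letter_val b k * word_val w.
Proof.
move=> r; rewrite /push word_val_consl letter_valM -gmulA.
by rewrite -word_val_consl consl_split.
Qed.

Lemma word_valM : is_hom (word_val \o lst).
Proof.
move=> a c /=; elim/fp_ind: a => [|b k a h n hd IH].
  by rewrite !gmul1.
rewrite -gmulA lst_embM // word_val_push ?lst_red // IH.
by rewrite lst_embM // word_val_push ?lst_red // gmulA.
Qed.

Lemma word_val_emb b k : side b k -> word_val (lst (emb b k)) = letter_val b k.
Proof. by move=> h; rewrite lst_emb // word_val_consl mulg1. Qed.

End Universal.

Lemma freeprod_coproduct : coproduct in1 in2.
Proof.
split; [exact: in1_hom | exact: in2_hom | |].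
  move=> H f1 f2 f1M f2M; exists (word_val f1 f2 \o lst); split.
  - exact: word_valM.
  - by move=> x /=; rewrite word_val_emb.
  - by move=> x /=; rewrite word_val_emb.
move=> P P1 P2 PM a; elim/fp_ind: a => [|b k a h _ _ IH].
  by rewrite -(hom1 in1_hom).
apply: PM => //; case: b h => h; first by rewrite emb_true.
by rewrite emb_false.
Qed.

(** Sides alternate in a reduced word, so such a word has at most one letter: this is a boolean test
    for membership in the free factor [b]. *)
Definition inF b a : bool := all (fun l => l.1 == b) (lst a).

Lemma inF_emb b k : side b k -> inF b (emb b k).
Proof.
by move=> h; rewrite /inF lst_emb // /consl; case: asboolP => //= _; rewrite eqxx.
Qed.

Lemma inFP b a : inF b a -> exists2 k, side b k & a = emb b k.
Proof.
elim/fp_ind: a => [_|c k a h n hd _].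
  by exists 1; [apply: side1 | rewrite emb1].
rewrite /inF lst_embM_cons //= => /andP[/eqP ecb].
subst c; rewrite /hs in hd; case E: (lst a) hd => [|l u] /=.
  move=> _ _; exists k => //; apply: lst_inj.
  by rewrite lst_embM_cons ?lst_emb /hs ?E // /consl asboolF.
by rewrite /headside /= => hd /andP[/eqP e]; rewrite e eqxx in hd.
Qed.

Lemma inFM b x y : inF b x -> inF b y -> inF b (x * y).
Proof.
move=> /inFP[k h ->] /inFP[k' h' ->]; rewrite -embM //.
by apply: inF_emb; apply: sideM.
Qed.

Lemma inFV b x : inF b x -> inF b x^-1.
Proof. by rewrite /inF lstV all_rev all_map. Qed.

Lemma inF_conjg b x y : inF b x -> inF b y -> inF b (conjg x y).
Proof. by move=> hx hy; apply: inFM; [apply: inFM | apply: inFV]. Qed.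

Lemma in1P x : inF true x -> exists t, x = in1 t.
Proof. by move=> /inFP[k h ->]; exists k.1; rewrite emb_true. Qed.

Lemma in2P x : inF false x -> exists t, x = in2 t.
Proof. by move=> /inFP[k h ->]; exists k.2; rewrite emb_false. Qed.

Lemma inF_in1 (t : G1) : inF true (in1 t). Proof. exact: inF_emb. Qed.

Lemma inF_in2 (t : G2) : inF false (in2 t). Proof. exact: inF_emb. Qed.

Lemma inF_hs b x : inF b x -> x <> 1 -> hs x = Some b.
Proof.
rewrite /inF /hs => + n; case E: (lst x) => [|l u] /=.
  by case: n; apply: lst_inj.
by rewrite /headside /= => /andP[/eqP->].
Qed.

Lemma inF_ls b x : inF b x -> x <> 1 -> ls x = Some b.
Proof.
move=> h n; rewrite -hsV; apply: inF_hs; first exact: inFV.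
by move=> /invg_eq1.
Qed.

Lemma inF_size b x : inF b x -> (size (lst x) <= 1)%N.
Proof.
move=> /inFP[k h ->]; rewrite lst_emb // /consl.
by case: asboolP.
Qed.

Lemma lst_cat_junction a c : ls a != hs c -> lst (a * c) = lst a ++ lst c.
Proof.
move=> n; apply: lstM_cat; rewrite red_cat !lst_red /junction /=.
by rewrite -/(hs c) -/(ls a) n orbT.
Qed.

Lemma hs_cat a c : a <> 1 -> lst (a * c) = lst a ++ lst c -> hs (a * c) = hs a.
Proof.
move=> n e; rewrite /hs e headside_cat; case E: (lst a) => //.
by case: n; apply: lst_inj.
Qed.

Lemma size_push b k w : (size (push b k w) <= (size w).+1)%N.
Proof.
rewrite /push; case: w => [|l w] /=; rewrite /consl; first by case: asboolP.
by case: eqP => _ /=; case: asboolP => _ //=; rewrite ltnW.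
Qed.

Lemma size_mulw u v : (size (mulw u v) <= size u + size v)%N.
Proof. by elim: u => //= l u IH; apply: leq_trans (size_push _ _ _) _. Qed.

Lemma size_mul_merge a c b : ls a = Some b -> hs c = Some b ->
  (size (lst (a * c)%grp) < size (lst a) + size (lst c))%N.
Proof.
rewrite lstM /ls /hs /lastside; case/lastP: (lst a) => [|u [b1 k]] //.
rewrite rev_rcons /= => -[->]; case: (lst c) => [|[b2 k'] w] //= [->].
rewrite -cats1 {1}/mulw foldr_cat -/(mulw _ _) /= size_cat /= addn1 addSnnS.
apply: leq_ltn_trans (size_mulw _ _) _; rewrite ltn_add2l.
by rewrite /push /= eqxx /consl; case: asboolP.
Qed.

Lemma split_right b a : exists a' y,
  [/\ inF b y, ls a' != Some b & a = a' * y].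
Proof.
case E: (ls a == Some b); last by exists a, 1; rewrite mulg1 E.
move: E (lst_red a); rewrite /ls; move e: (lst a) => w.
case/lastP: w e => [|u [c k]] // e.
rewrite /lastside rev_rcons /= => /eqP[ec] r; subst c.
have := r; rewrite -cats1 red_cat => /and3P[ru rk j].
exists (mkfp ru), (mkfp rk); split.
- by rewrite /inF /= eqxx.
- move: j; rewrite /junction /ls lst_mkfp -/(lastside u).
  by case/orP => [/eqP->|].
- by apply: lst_inj; rewrite lstM_cat /= ?cats1.
Qed.

Lemma split_left b a : exists y a',
  [/\ inF b y, hs a' != Some b & a = y * a'].
Proof.
have [a' [y [h n e]]] := split_right b a^-1.
exists y^-1, a'^-1; split; first exact: inFV.
  by rewrite hsV.
by rewrite -invMg -e invgK.
Qed.

Lemma conjg_nf b a x : inF b x -> x <> 1 -> ls a != Some b ->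
  lst (conjg a x) = lst a ++ lst x ++ lst a^-1.
Proof.
move=> h n hl; rewrite /conjg -gmulA.
have e : lst (x * a^-1) = lst x ++ lst a^-1.
  by apply: lst_cat_junction; rewrite (inF_ls h n) hsV eq_sym.
rewrite -e; apply: lst_cat_junction.
by rewrite (hs_cat n e) (inF_hs h n).
Qed.

(** Absorb the last letter of [a] into [x] if it lies on side [b]. What remains of [a] conjugates
    without cancellation, so all its letters would show in the normal form of the conjugate; a word
    with a single letter leaves no room for them. *)
Lemma malnormal b b' a x : inF b x -> x <> 1 -> inF b' (conjg a x) ->
  b = b' /\ inF b a.
Proof.
have [a' [y [hy na ->]]] := split_right b a.
rewrite conjMg => hx nx; set x' := conjg y x.
have hx' : inF b x' by apply: inF_conjg.
have nx' : x' <> 1.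
  by move=> e; apply: nx; rewrite -(conjgK y x) -/x' e conjg_fix //; apply: commute1.
rewrite {1}/inF (conjg_nf hx' nx' na) !all_cat => /and3P[ha hx2 _].
have eb : b = b'.
  have /inF_hs := hx2; rewrite (inF_hs hx' nx') => /(_ nx').
  by case.
split=> //; suff -> : a' = 1 by rewrite gmul1.
apply: contrapT => n; move: na; rewrite (@inF_ls b' a') // eb.
by rewrite eqxx.
Qed.

Lemma centralizer_factor b x a : inF b x -> x <> 1 -> commute x a -> inF b a.
Proof.
move=> h n /commute_sym/conjg_fix e.
by have [] := @malnormal b b a x h n; rewrite ?e.
Qed.

End FreeProductTheory.

(** * Centralizers in free products *)

Section CommutingWords.
Variable T : Type.
Implicit Types u v w : seq T.

Lemma commuting_prefix u v n :
  u ++ v = v ++ u -> (size v <= size (flatten (nseq n u)))%N ->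
  v = take (size v) (flatten (nseq n u)).
Proof.
move=> e h; rewrite -(takel_cat v h).
suff -> : flatten (nseq n u) ++ v = v ++ flatten (nseq n u).
  by rewrite take_size_cat.
by elim: n {h} => [|n IH] /=; rewrite ?cats0 // -catA IH !catA e.
Qed.

(** Words commuting with [u] are prefixes of powers of [u]. Both [v ++ w] and [w ++ v] commute with
    [u] and have the same length, hence are the same prefix. *)
Lemma commuting_words u v w :
  u <> [::] -> u ++ v = v ++ u -> u ++ w = w ++ u -> v ++ w = w ++ v.
Proof.
move=> n ev ew.
have e v' w' : u ++ v' = v' ++ u -> u ++ w' = w' ++ u ->
    v' ++ w' = take (size v' + size w')
                 (flatten (nseq (size v' + size w') u)).
  move=> ev' ew'; rewrite -size_cat; apply: commuting_prefix.
    by rewrite catA ev' -catA ew' catA.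
  rewrite size_flatten /shape map_nseq sumn_nseq.
  by case: u n {ev ew ev' ew'} => // t u _ /=; rewrite leq_pmull.
by rewrite (e v w) // (e w v) // addnC.
Qed.

End CommutingWords.

Definition commutative_transitive (G : Grp) :=
  forall x y z : G, x <> 1 -> commute x y -> commute x z -> commute y z.

(* A group of this kind cannot act on the Bass-Serre tree of a free product
   without fixing a vertex. *)
Definition elliptic_group (G : Grp) := exists x y : G,
  [/\ x <> 1, y <> 1 & commute x y] /\
  (exists s t, [/\ commute x s, commute x t & ~ commute s t]) /\
  (forall g, exists s t, [/\ g = s * t, commute x s & commute y t]).

Section FreeProductCentralizers.
Variables G1 G2 : Grp.
Local Notation A := (freeprod G1 G2).
Implicit Types (b : bool) (a c x y z g h : A).

Lemma commute_conjg c x y : commute x y -> commute (conjg c x) (conjg c y).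
Proof. exact: (hom_commute (conjgM c)). Qed.

Lemma conjg_commute c x y : commute (conjg c x) (conjg c y) -> commute x y.
Proof. exact: (inj_commute (conjgM c) (can_inj (conjgK c))). Qed.

Lemma conjg_eq1 c x : conjg c x = 1 -> x = 1.
Proof. by move=> e; rewrite -(conjgK c x) e conjg_fix //; apply: commute1. Qed.

(** Induction on length: if the first and last letters of a longer word are on the same side,
    conjugating the first letter to the end merges the two and shortens the word. *)
Lemma cyclic_reduction a : exists c,
  (exists b, inF b (conjg c a)) \/
  (exists b b', [/\ hs (conjg c a) = Some b, ls (conjg c a) = Some b' & b <> b']).
Proof.
have [n] := ubnP (size (lst a)); elim: n a => // n IH a sa.
have trivial_case : a = 1 -> exists c, (exists b, inF b (conjg c a)) \/
  (exists b b', [/\ hs (conjg c a) = Some b, ls (conjg c a) = Some b' & b <> b']).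
  by move=> ->; exists 1; left; exists true; rewrite conj1g.
case hb: (hs a) => [b|]; last exact/trivial_case/hs_None.
case lb: (ls a) => [b'|]; last exact/trivial_case/ls_None.
have [e|ne] := eqVneq b b'; last first.
  by exists 1; right; exists b, b'; rewrite conj1g; split=> //; apply/eqP.
subst b'; have [y [a' [hy na ea]]] := split_left b a.
have ny : y <> 1.
  by move=> e; move: na; rewrite -(gmul1 a') -e -ea hb eqxx.
have el : lst a = lst y ++ lst a'.
  by rewrite ea; apply: lst_cat_junction; rewrite (inF_ls hy ny) eq_sym.
have [e1|na'] := pselect (a' = 1).
  by exists 1; left; exists b; rewrite conj1g ea e1 mulg1.
have la' : ls a' = Some b.
  move: lb; rewrite /ls el lastside_cat; case E: (lst a') => //.
  by case: na'; apply: lst_inj.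
have [|c hc] := IH (conjg y^-1 a); last by exists (c * y^-1); rewrite conjMg.
have -> : conjg y^-1 a = a' * y by rewrite ea /conjg invgK mulKg.
apply: leq_trans (size_mul_merge la' (inF_hs hy ny)) _.
by rewrite addnC -size_cat -el -ltnS.
Qed.

Lemma winvl_cat (u v : seq (letter G1 G2)) :
  winvl (u ++ v) = winvl v ++ winvl u.
Proof. by rewrite /winvl map_cat rev_cat. Qed.

(** The product [h * g] has no cancellation, so its length is the sum of the lengths. Then [g * h]
    has that length too, which excludes a merge at its junction; the group identity becomes an
    identity of words. *)
Lemma hyperbolic_commute_words b b' h g :
  hs h = Some b -> ls h = Some b' -> b <> b' -> hs g = Some b ->
  commute h g -> lst g ++ lst h = lst h ++ lst g.
Proof.
move=> hh lh n hg e.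
have e1 : lst (h * g) = lst h ++ lst g.
  by apply: lst_cat_junction; rewrite lh hg; apply/eqP => -[/esym].
rewrite -e1 e; symmetry; apply: lst_cat_junction; apply/eqP => lg.
have := @size_mul_merge _ _ g h b; rewrite lg hh -e e1 size_cat addnC ltnn.
by move=> H; have := H erefl erefl.
Qed.

Lemma hyperbolic_centralizer b b' h g :
  hs h = Some b -> ls h = Some b' -> b <> b' -> commute h g ->
  lst g ++ lst h = lst h ++ lst g \/ lst g^-1 ++ lst h = lst h ++ lst g^-1.
Proof.
move=> hh lh n e; case hg: (hs g) => [d|]; last first.
  by left; rewrite (hs_None hg) lst1 cats0.
have [ed|nd] := eqVneq d b.
  by left; apply: (hyperbolic_commute_words hh lh n) => //; rewrite hg ed.
right; have ed : d = b' by case: d b b' nd n {hh lh hg} => [] [] [].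
(* Here [g] starts on the side where [h] ends, that is, where [h^-1] starts; inverting the resulting
   word identity gives the one for [g^-1]. *)
have := @hyperbolic_commute_words b' b h^-1 g.
rewrite hsV lsV => /(_ lh hh (nesym n)); rewrite hg ed => /(_ erefl).
move/(_ (commute_sym (commuteV (commute_sym e))))/(congr1 (@winvl _ _)).
by rewrite !winvl_cat -!lstV invgK.
Qed.

Lemma lst_commute x y : lst x ++ lst y = lst y ++ lst x -> commute x y.
Proof.
move=> e; apply: lst_inj; rewrite !lstM.
have E (u : seq (letter G1 G2)) : red u -> mulw u [::] = u by move=> r; rewrite mulw_cat ?cats0.
rewrite -{1}(E (lst y) (lst_red y)) -{2}(E (lst x) (lst_red x)).
by rewrite /mulw -!foldr_cat e.
Qed.

Lemma hyperbolic_abelian b b' h y z :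
  hs h = Some b -> ls h = Some b' -> b <> b' ->
  commute h y -> commute h z -> commute y z.
Proof.
move=> hh lh n ey ez.
have nh : lst h <> [::] by move: hh; rewrite /hs; case: (lst h).
have C s t : lst s ++ lst h = lst h ++ lst s ->
    lst t ++ lst h = lst h ++ lst t -> commute s t.
  by move=> es et; apply: lst_commute; apply: (commuting_words nh).
have [cy|cy] := hyperbolic_centralizer hh lh n ey;
have [cz|cz] := hyperbolic_centralizer hh lh n ez.
- exact: C.
- by rewrite -(invgK z); apply: commuteV; apply: C.
- by rewrite -(invgK y); apply/commute_sym/commuteV/commute_sym; apply: C.
- rewrite -(invgK z); apply: commuteV.
  by rewrite -(invgK y); apply/commute_sym/commuteV/commute_sym; apply: C.
Qed.

(** Otherwise a cyclically reduced conjugate of [x] starts and ends on different sides, and its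
    centralizer is abelian by the word combinatorics above. *)
Lemma elliptic_of_centralizer x y z :
  commute x y -> commute x z -> ~ commute y z -> exists c b, inF b (conjg c x).
Proof.
move=> exy exz n; have [c [[b h]|[b [b' [h1 h2 h3]]]]] := cyclic_reduction x.
  by exists c, b.
case: n; apply: (@conjg_commute c).
by apply: (hyperbolic_abelian h1 h2 h3); apply: commute_conjg.
Qed.

(** A failure of transitivity at [x] is a non-abelian centralizer, so [x] is conjugate into a
    factor. That factor then contains the conjugated centralizer, and its own transitivity
    applies. *)
Lemma freeprod_commutative_transitive :
  commutative_transitive G1 -> commutative_transitive G2 ->
  commutative_transitive A.
Proof.
move=> CT1 CT2 x y z n exy exz; apply: contrapT => nyz.
have [c [b h]] := elliptic_of_centralizer exy exz nyz.
have n' : conjg c x <> 1 by move/conjg_eq1.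
case: nyz; apply: (@conjg_commute c).
move/(@commute_conjg c): exy => exy; move/(@commute_conjg c): exz => exz.
have hy := centralizer_factor h n' exy; have hz := centralizer_factor h n' exz.
move: h hy hz n' exy exz; case: b.
  move=> /in1P[s ->] /in1P[t ->] /in1P[r ->] n' e e'.
  apply: (hom_commute (@in1_hom _ _)); apply: (CT1 s).
  - by move=> es; apply: n'; rewrite es (hom1 (@in1_hom _ _)).
  - exact: (inj_commute (@in1_hom _ _) (@in1_inj _ _) e).
  - exact: (inj_commute (@in1_hom _ _) (@in1_inj _ _) e').
move=> /in2P[s ->] /in2P[t ->] /in2P[r ->] n' e e'.
apply: (hom_commute (@in2_hom _ _)); apply: (CT2 s).
- by move=> es; apply: n'; rewrite es (hom1 (@in2_hom _ _)).
- exact: (inj_commute (@in2_hom _ _) (@in2_inj _ _) e).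
- exact: (inj_commute (@in2_hom _ _) (@in2_inj _ _) e').
Qed.

(** The non-abelian centralizer of [x] puts a conjugate of its image in a factor. Centralizers of
    nontrivial elements of a factor stay in it, so membership spreads from [x] to [y], and then to
    both centralizers, whose products exhaust [G]. *)
Lemma elliptic_group_factor (G : Grp) (f : G -> A) :
  is_hom f -> injective f -> elliptic_group G ->
  exists c b, forall r, inF b (conjg c (f r)).
Proof.
move=> fM fI [x [y [[nx ny exy] [[s [t [es et nst]]] gen]]]].
have f_neq1 r : r <> 1 -> f r <> 1 by move=> n e; apply: n; apply: fI; rewrite e hom1.
have [||n|c [b h]] := @elliptic_of_centralizer (f x) (f s) (f t).
- exact: hom_commute.
- exact: hom_commute.
- by apply: nst; apply: (inj_commute fM fI).
exists c, b => g; have [p [q [-> ep eq]]] := gen g.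
have N r : r <> 1 -> conjg c (f r) <> 1 by move=> n /conjg_eq1; apply: f_neq1.
have C r r' : r <> 1 -> inF b (conjg c (f r)) -> commute r r' ->
    inF b (conjg c (f r')).
  move=> n hr e; apply: (centralizer_factor hr (N _ n)).
  by apply: commute_conjg; apply: hom_commute.
rewrite fM conjgM; apply: inFM; first exact: (C x).
by apply: (C y) => //; apply: (C x).
Qed.

End FreeProductCentralizers.

(** * Automorphisms of a free product preserve the factors up to conjugation *)

Definition central (G : Grp) (x : G) := forall y, commute x y.

Section FreeProductAutomorphisms.
Variables G1 G2 : Grp.
Local Notation A := (freeprod G1 G2).
Implicit Types (b : bool) (a c x y z g h w : A) (phi psi : automorphism A).

Lemma not_trivial_centre_nontrivial (G : Grp) :
  ~ trivial_centre G -> exists2 x : G, central x & x <> 1.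
Proof.
move=> n; apply: contrapT => n'; apply: n => z zC.
by apply: contrapT => nz; apply: n'; exists z.
Qed.

Definition preserves_factors psi := forall b a, inF b (psi a) = inF b a.

Lemma inF_conjg_eq b x y : inF b x -> inF b (conjg x y) = inF b y.
Proof.
move=> h; apply/idP/idP => [h'|]; last exact: inF_conjg.
by rewrite -(conjgK x y); apply: inF_conjg => //; apply: inFV.
Qed.

Lemma inF_both x : inF true x -> inF false x -> x = 1.
Proof.
move=> h1 h2; apply: contrapT => n.
by have := inF_hs h1 n; rewrite (inF_hs h2 n).
Qed.

(** Surjectivity forces [w = 1]. A nontrivial [w] would start in the second factor and end in the
    first, so letters of the second factor would have images [w y w^-1] that are long and never
    cancel against neighbouring images; no single letter of the second factor could then be
    attained. *)
Lemma untwist psi w :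
  (exists2 x : A, inF false x & x <> 1) ->
  (forall a, inF true (psi a) = inF true a) ->
  (forall a, inF false (conjg w^-1 (psi a)) = inF false a) ->
  hs w <> Some true -> ls w <> Some false -> w = 1.
Proof.
move=> [x0 hx0 nx0] h1 h2 nh nl; apply: contrapT => nw.
have hw : hs w = Some false.
  by case E: (hs w) nh => [[]|] //; case: nw; apply: hs_None.
have psi1 a : psi a = 1 -> a = 1.
  by move=> e; apply: (@aut_inj _ psi); rewrite e (hom1 (@is_hom_aut _ psi)).
(* Preservation of the starting side is what rules out cancellation in the induction; the bound 2
   counts a letter each from [w], [y] and [w^-1]. *)
have H a : hs (psi a) = hs a /\ (hs a = Some false -> (2 < size (lst (psi a)))%N).
  elim/fp_ind: a => [|b k a h n hd [IH _]].
    by rewrite (hom1 (@is_hom_aut _ psi)).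
  have he := inF_emb h; set e := emb b k in he *.
  have ne : e <> 1.
    by move=> e1; apply: n; apply: (@emb_inj _ _ b) => //; [apply: side1 | rewrite emb1].
  have -> : hs (e * a) = Some b by rewrite /hs lst_embM_cons.
  rewrite afunM; case: b h hd {n} @e he ne => h hd e he ne.
    have hx : inF true (psi e) by rewrite h1.
    have nx : psi e <> 1 by move/psi1.
    have ec : lst (psi e * psi a) = lst (psi e) ++ lst (psi a).
      by apply: lst_cat_junction; rewrite (inF_ls hx nx) IH eq_sym.
    by rewrite (hs_cat nx ec) (inF_hs hx nx).
  set y := conjg w^-1 (psi e).
  have hy : inF false y by rewrite h2.
  have ny : y <> 1 by move=> /conjg_eq1/psi1.
  have ey : psi e = conjg w y by rewrite conjgKV.
  have ly : lst (psi e) = lst w ++ lst y ++ lst w^-1.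
    by rewrite ey; apply: (conjg_nf hy) => //; apply/eqP.
  have hpe : hs (psi e) = Some false.
    by rewrite -hw /hs ly headside_cat; case E: (lst w) => //; case: nw; apply: lst_inj.
  have npe : psi e <> 1 by move/psi1.
  have lpe : ls (psi e) = Some false.
    rewrite -hw -lsV /ls ly catA lastside_cat; case E: (lst w^-1) => //.
    by case: nw; apply: (@invg_eq1 A); apply: lst_inj.
  have ec : lst (psi e * psi a) = lst (psi e) ++ lst (psi a).
    by apply: lst_cat_junction; rewrite lpe IH eq_sym.
  rewrite (hs_cat npe ec) hpe; split=> // _.
  have S z : z <> 1 -> (0 < size (lst z))%N.
    by move=> nz; rewrite lt0n; apply/eqP => /size0nil e0; apply: nz; apply: lst_inj.
  rewrite ec ly !size_cat size_lstV.
  have := S _ nw; have := S _ ny.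
  by case: (size (lst w)) => // m; case: (size (lst y)) => // m' _ _; rewrite !addSn !addnS.
(* The preimage of the one-letter element [x0] contradicts the length bound. *)
have [e] := H (ainv psi x0); rewrite ainvK in e *.
rewrite -e (inF_hs hx0 nx0) => /(_ erefl).
by have := inF_size hx0; case: (size _) => [|[|n]].
Qed.

Hypotheses (E1 : elliptic_group G1) (E2 : elliptic_group G2).
Hypotheses (Z1 : trivial_centre G1) (Z2 : ~ trivial_centre G2).

Lemma elliptic_group_neq1 (G : Grp) : elliptic_group G -> exists x : G, x <> 1.
Proof. by move=> [x [y [[n _ _] _]]]; exists x. Qed.

Lemma inF_nontrivial b : exists2 x : A, inF b x & x <> 1.
Proof.
case: b.
  have [x n] := elliptic_group_neq1 E1; exists (in1 G2 x); first exact: inF_in1.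
  by move=> e; apply: n; apply: (@in1_inj _ G2); rewrite e (hom1 (@in1_hom _ _)).
have [x n] := elliptic_group_neq1 E2; exists (in2 G1 x); first exact: inF_in2.
by move=> e; apply: n; apply: (@in2_inj G1); rewrite e (hom1 (@in2_hom _ _)).
Qed.

Lemma central_factor1 x :
  inF true x -> (forall y, inF true y -> commute x y) -> x = 1.
Proof.
move=> /in1P[s ->] H; suff -> : s = 1 by rewrite (hom1 (@in1_hom _ _)).
apply: Z1 => t; apply: (inj_commute (@in1_hom _ _) (@in1_inj _ _)).
by apply: H; apply: inF_in1.
Qed.

Lemma central_factor2 :
  exists z : A, [/\ inF false z, z <> 1 & forall y, inF false y -> commute z y].
Proof.
have [s sC n] := not_trivial_centre_nontrivial Z2.
exists (in2 G1 s); split; first exact: inF_in2.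
  by move=> e; apply: n; apply: (@in2_inj G1); rewrite e (hom1 (@in2_hom _ _)).
by move=> y /in2P[t ->]; apply: (hom_commute (@in2_hom _ _)); apply: sC.
Qed.

Lemma factor_image_sub phi b :
  exists c b', forall a, inF b a -> inF b' (conjg c (phi a)).
Proof.
case: b.
  have [||c [b' H]] := @elliptic_group_factor _ _ _ (phi \o @in1 G1 G2) _ _ E1.
  - by apply: is_hom_comp; [apply: is_hom_aut | apply: in1_hom].
  - by apply: inj_comp; [apply: aut_inj | apply: in1_inj].
  by exists c, b' => a /in1P[x ->]; apply: H.
have [||c [b' H]] := @elliptic_group_factor _ _ _ (phi \o @in2 G1 G2) _ _ E2.
- by apply: is_hom_comp; [apply: is_hom_aut | apply: in2_hom].
- by apply: inj_comp; [apply: aut_inj | apply: in2_inj].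
by exists c, b' => a /in2P[x ->]; apply: H.
Qed.

(** Inclusions for [phi] and for its inverse are played against each other through malnormality; the
    centres then show that the side is unchanged. *)
Lemma factor_image phi b :
  exists c, forall a, inF b (conjg c (phi a)) = inF b a.
Proof.
have [c [b' H]] := factor_image_sub phi b.
have [c2 [b2 H2]] := factor_image_sub (aut_inv phi) b'.
have phiVC x : ainv phi (conjg c (phi x)) = conjg (ainv phi c) x.
  have /= -> := hom_conjg (@is_hom_aut _ (aut_inv phi)) c (phi x).
  by rewrite afunK.
set d := c2 * ainv phi c.
have Hd a : inF b' (conjg c (phi a)) -> inF b2 (conjg d a).
  by move=> /H2 /=; rewrite phiVC conjMg.
have [x0 hx0 nx0] := inF_nontrivial b.
(* The two inclusions compose to conjugation by [d], which sends a nontrivial element of factor [b]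
   into a factor. So this factor is [b] again and contains [d], and the first inclusion becomes an
   equivalence. *)
have [eb hd] := malnormal hx0 nx0 (Hd _ (H _ hx0)); subst b2.
have {H Hd}H a : inF b' (conjg c (phi a)) = inF b a.
  by apply/idP/idP => [/Hd|/H //]; rewrite inF_conjg_eq.
suff e : b' = b by exists c => a; rewrite -[RHS]H e.
pose f x := ainv phi (conjg c^-1 x).
have fK x : conjg c (phi (f x)) = x by rewrite /f ainvK conjgKV.
have C x y : commute (conjg c (phi x)) (conjg c (phi y)) <-> commute x y.
  split=> [/conjg_commute|e].
    exact: (inj_commute (@is_hom_aut _ phi) (@aut_inj _ phi)).
  by apply: commute_conjg; apply: (hom_commute (@is_hom_aut _ phi)).
(* If the sides were exchanged, this nontrivial central element of the second factor would
   correspond to a central element of the first, which is trivial. *)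
have [z [hz nz zC]] := central_factor2.
case: b b' {hx0 hd H2} H => [] [] // H.
  have h : inF true (f z) by rewrite -H fK.
  case: nz; rewrite -(fK z) (_ : f z = 1); last first.
    apply: central_factor1 => // y hy.
    by apply/C; rewrite fK; apply: zC; rewrite H.
  by rewrite (hom1 (@is_hom_aut _ phi)) conjg_fix //; apply: commute1.
case: nz; apply: (@aut_inj _ phi); rewrite (hom1 (@is_hom_aut _ phi)).
apply: (@conjg_eq1 _ _ c); apply: central_factor1; first by rewrite H.
by move=> y hy; rewrite -(fK y); apply/C; apply: zC; rewrite -H fK.
Qed.

Lemma aut_decomposition phi :
  exists c psi, preserves_factors psi /\ phi = aut_mul (ad c) psi.
Proof.
have [c1 H1] := factor_image phi true; have [c2 H2] := factor_image phi false.
(* The two conjugators differ by [c1 * c2^-1 = g * w * h], with [g] in the first factor and [h] in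
   the second. Conjugation by [g] or [h] preserves the corresponding factor, so only [w] measures
   the discrepancy, and [untwist] kills it. *)
have [g [w1 [hg nw1 ew]]] := split_left true (c1 * c2^-1).
have [w [h [hh nw ew1]]] := split_right false w1.
pose psi := aut_mul (ad (g^-1 * c1)) phi.
have w1E : w = 1.
  apply: (@untwist psi); first exact: inF_nontrivial.
  - by move=> a /=; rewrite conjMg inF_conjg_eq ?H1 //; apply: inFV.
  - move=> a /=; rewrite -[RHS]H2 -[RHS](inF_conjg_eq _ hh) -!conjMg.
    congr (inF _ (conjg _ _)); apply: (@mulgI _ w).
    rewrite gmulA mulgV gmul1 gmulA -ew1; apply: (@mulgI _ g).
    by rewrite mulKVg gmulA -ew -gmulA gmulV mulg1.
  - move=> hw; move: nw1; rewrite ew1.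
    have [-> |nh] := pselect (h = 1); first by rewrite mulg1 hw eqxx.
    rewrite (@hs_cat _ _ w h) ?hw //.
      by move=> we; move: hw; rewrite we.
    by apply: lst_cat_junction; rewrite (inF_hs hh nh).
  - by move=> lw; rewrite lw eqxx in nw.
exists (g^-1 * c1)^-1, psi; split; last first.
  by apply: aut_ext => a; rewrite /= conjgK.
case=> a /=; first by rewrite conjMg inF_conjg_eq ?H1 //; apply: inFV.
rewrite -[RHS]H2 -[RHS](inF_conjg_eq _ hh) -!conjMg.
congr (inF _ (conjg _ _)).
rewrite w1E gmul1 in ew1; apply: (@mulgI _ g).
by rewrite mulKVg gmulA -ew1 -ew mulgKV.
Qed.

Lemma centralizer_factor1 c : (forall x : G1, commute c (in1 G2 x)) -> c = 1.
Proof.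
move=> H; have C y : inF true y -> commute c y by move=> /in1P[x ->].
have [x hx n] := inF_nontrivial true.
apply: central_factor1 => //.
by apply: (centralizer_factor hx n); apply/commute_sym/C.
Qed.

Lemma freeprod_trivial_centre : trivial_centre A.
Proof. by move=> c H; apply: centralizer_factor1 => x; apply: H. Qed.

End FreeProductAutomorphisms.

Definition isomorphic (G H : Grp) := exists (f : G -> H) (g : H -> G),
  [/\ is_hom f, cancel f g & cancel g f].

Definition nonabelian (G : Grp) := exists x y : G, ~ commute x y.

Lemma centralized_trivial (G : Grp) (x : G) :
  commutative_transitive G -> nonabelian G -> central x -> x = 1.
Proof.
move=> CT [s [t n]] xC; apply: contrapT => nx; apply: n.
exact: (CT x s t).
Qed.

Lemma nonabelian_nontrivial (G : Grp) : nonabelian G -> exists x : G, x <> 1.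
Proof.
by move=> [x [y n]]; exists x => e; apply: n; rewrite e; apply/commute_sym/commute1.
Qed.

(** * Automorphisms of direct products *)

Section DirectDecomposition.
Variables (G : Grp) (B : nat -> Grp) (k : nat).
Variables (inj : forall i, B i -> G) (pr : forall i, G -> B i).

(** The maps exist for every index, which avoids types bounded by [k]; the retraction law and joint
    injectivity involve only indices below [k]. *)
Record direct_decomposition : Prop := DirectDecomposition {
  injM : forall i, is_hom (@inj i);
  prM : forall i, is_hom (@pr i);
  pr_inj : forall i x, (i < k)%N -> pr i (inj x) = x;
  pr_inj1 : forall i j (x : B i), i <> j -> pr j (inj x) = 1;
  pr_ext : forall x y, (forall i, (i < k)%N -> pr i x = pr i y) -> x = y }.

Hypothesis D : direct_decomposition.
Hypothesis CT : forall i, commutative_transitive (B i).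
Hypothesis NA : forall i, nonabelian (B i).
Hypothesis NI : forall i j, isomorphic (B i) (B j) -> i = j.

Implicit Types (i j l m : nat) (x y z g : G).

Lemma pr1 i : pr i 1 = 1. Proof. exact: hom1 (prM D i). Qed.

Lemma inj_injective i : (i < k)%N -> injective (@inj i).
Proof. by move=> h x y e; rewrite -(pr_inj D x h) e pr_inj. Qed.

Lemma commute_pr x y :
  (forall i, (i < k)%N -> commute (pr i x) (pr i y)) -> commute x y.
Proof. by move=> H; apply: (pr_ext D) => i h; rewrite !(prM D); apply: H. Qed.

Lemma pr_commute i x y : commute x y -> commute (pr i x) (pr i y).
Proof. by move=> e; apply: (hom_commute (prM D i) e). Qed.

Lemma commute_inj i j (x : B i) (y : B j) : i <> j -> commute (inj x) (inj y).
Proof.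
move=> n; apply: commute_pr => l _.
have [->|/eqP nl] := eqVneq l i; last first.
  by rewrite (pr_inj1 D x (nesym nl)); apply/commute_sym/commute1.
by rewrite (pr_inj1 D y (nesym n)); apply: commute1.
Qed.

(** Each other component of [x] is central in a nonabelian commutative transitive block, hence
    trivial. *)
Lemma centralizer_complement i x :
  (forall j (y : B j), j <> i -> commute x (inj y)) -> x = inj (pr i x).
Proof.
move=> H; apply: (pr_ext D) => j h; have [e|/eqP n] := eqVneq j i.
  by subst j; rewrite (pr_inj D).
rewrite (pr_inj1 D _ (nesym n)); apply: (centralized_trivial (@CT j) (NA j)) => y.
by rewrite -[y](pr_inj D _ h); apply: pr_commute; apply: H.
Qed.

(* [inj j (pr j (phi (inj i x)))] commutes with the image of every other
   factor, so it comes from the i-th factor again. *)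
Lemma component_preimage (phi : automorphism G) i j (x : B i) :
  (i < k)%N -> exists y : B i, phi (inj y) = inj (pr j (phi (inj x))).
Proof.
move=> hi; exists (pr i (ainv phi (inj (pr j (phi (inj x)))))).
rewrite -centralizer_complement ?ainvK // => l y n.
apply: (inj_commute (@is_hom_aut _ phi) (@aut_inj _ phi)); rewrite ainvK.
apply: commute_pr => m hm; have [e|/eqP nm] := eqVneq m j.
  subst m; rewrite (pr_inj D) //; apply: pr_commute.
  by apply: (hom_commute (@is_hom_aut _ phi)); apply: commute_inj; apply: nesym.
by rewrite (pr_inj1 D _ (nesym nm)); apply/commute_sym/commute1.
Qed.

(** Suppose the image has nontrivial components in two blocks. Pulled back to [B i], different
    components commute; commutative transitivity then makes each component map have commuting
    values, so [B i] would be abelian. *)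
Lemma factor_to_factor (phi : automorphism G) i :
  (i < k)%N -> exists2 j, (j < k)%N &
    forall x : B i, phi (inj x) = inj (pr j (phi (inj x))).
Proof.
move=> hi; have [x0 n0] := nonabelian_nontrivial (NA i).
have phi_inj_eq1 (x : B i) : phi (inj x) = 1 -> x = 1.
  move=> e; apply: (inj_injective hi); apply: (@aut_inj _ phi).
  by rewrite e (hom1 (injM D (i:=i))) (hom1 (@is_hom_aut _ phi)).
have [j [hj nj]] : exists j, (j < k)%N /\ pr j (phi (inj x0)) <> 1.
  apply: contrapT => H; apply: n0; apply: phi_inj_eq1; apply: (pr_ext D) => j hj.
  by rewrite pr1; apply: contrapT => n; apply: H; exists j.
exists j => // x; apply: (pr_ext D) => l hl; have [e|/eqP nl] := eqVneq l j.
  by subst l; rewrite (pr_inj D).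
rewrite (pr_inj1 D _ (nesym nl)); apply: contrapT => nx.
pose c m (y : B i) := sval (cid (component_preimage phi m y hi)).
have cE m (y : B i) : phi (inj (c m y)) = inj (pr m (phi (inj y))).
  by rewrite /c; case: cid.
have c_neq1 m (y : B i) : (m < k)%N -> pr m (phi (inj y)) <> 1 -> c m y <> 1.
  move=> hm n e; apply: n; apply: (inj_injective hm).
  by rewrite -cE e !(hom1 (injM D (i:=_))) (hom1 (@is_hom_aut _ phi)).
have cC m m' (y y' : B i) : m <> m' -> commute (c m y) (c m' y').
  move=> n; apply: (inj_commute (injM D (i:=i)) (inj_injective hi)).
  apply: (inj_commute (@is_hom_aut _ phi) (@aut_inj _ phi)); rewrite !cE.
  exact: commute_inj.
have [s [t]] := NA i; apply.
apply: (inj_commute (injM D (i:=i)) (inj_injective hi)).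
apply: (inj_commute (@is_hom_aut _ phi) (@aut_inj _ phi)).
apply: commute_pr => m hm.
suff e : commute (c m s) (c m t).
  rewrite -(pr_inj D (pr m (phi (inj s))) hm) -(pr_inj D (pr m (phi (inj t))) hm).
  rewrite -!cE; apply: pr_commute; apply: (hom_commute (@is_hom_aut _ phi)).
  exact: (hom_commute (injM D (i:=i))).
(* The nontrivial element commuting with both must come from another component: [c l x] when [m] is
   [j], and [c j x0] otherwise. *)
have [e|/eqP nm] := eqVneq m j.
  subst m; apply: (CT (c_neq1 _ _ hl nx)); apply: cC => // e.
apply: (CT (c_neq1 _ _ hj nj)); apply: cC; exact: nesym.
Qed.

(** The inverse automorphism must send block [j] back into block [i], so the two blocks are
    isomorphic and [NI] identifies the indices. *)
Lemma factor_preserved (phi : automorphism G) i (x : B i) :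
  (i < k)%N -> phi (inj x) = inj (pr i (phi (inj x))).
Proof.
move=> hi; have [j hj H] := factor_to_factor phi hi.
have [m hm H'] := factor_to_factor (aut_inv phi) hj.
have back (y : B i) : ainv phi (inj (pr j (phi (inj y)))) = inj y.
  by rewrite -H afunK.
have em : m = i.
  have [x0 n0] := nonabelian_nontrivial (NA i).
  apply: contrapT => n; apply: n0; apply: (inj_injective hi).
  have := H' (pr j (phi (inj x0))); rewrite /= back => ->.
  by rewrite (pr_inj1 D) ?(hom1 (injM D (i:=_))) //; apply: nesym.
subst m; suff e : i = j by subst j.
apply: NI; exists (fun y : B i => pr j (phi (inj y))),
  (fun y : B j => pr i (ainv phi (inj y))).
split=> [y y'|y|y].
- by rewrite (injM D) afunM (prM D).
- by rewrite back (pr_inj D).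
- by have /= <- := H' y; rewrite ainvK (pr_inj D).
Qed.

(** Split [g] as its [i]-th part times [r]. Since [r] centralizes block [i], which [phi] preserves,
    the [i]-th component of [phi r] is central in [B i], hence trivial. *)
Lemma aut_projection (phi : automorphism G) i g :
  (i < k)%N -> phi (inj (pr i g)) = inj (pr i (phi g)).
Proof.
move=> hi; pose p := inj (pr i g); pose r := p^-1 * g.
have eg : g = p * r by rewrite /r mulKVg.
have pr_r : pr i r = 1.
  by rewrite /r (prM D) (homV (prM D i)) (pr_inj D) // gmulV.
have rC (y : B i) : commute r (inj y).
  apply: commute_pr => l hl; have [e|/eqP n] := eqVneq l i.
    by subst l; rewrite pr_r; apply/commute_sym/commute1.
  by rewrite (pr_inj1 D _ (nesym n)); apply: commute1.
have pr_phi_r : pr i (phi r) = 1.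
  apply: (centralized_trivial (@CT i) (NA i)) => y.
  have := factor_preserved (aut_inv phi) y hi; set y' := pr i _ => /= ey.
  rewrite -[y](pr_inj D _ hi) -(ainvK phi (inj y)) ey.
  by apply: pr_commute; apply: (hom_commute (@is_hom_aut _ phi)).
rewrite -/p eg afunM (prM D) pr_phi_r mulg1.
exact: factor_preserved.
Qed.

End DirectDecomposition.

Lemma unitgA (x y z : unit) : tt = tt. Proof. by []. Qed.
Lemma unitg1 (x : unit) : tt = x. Proof. by case: x. Qed.

Definition unitg : Grp :=
  @MkGrp unit (fun _ _ => tt) tt (fun _ => tt) unitgA unitg1 (fun x => unitgA x x x).

Fixpoint prodn (B : nat -> Grp) (k : nat) : Grp :=
  if k is k'.+1 then prodg (B 0%N) (prodn (fun i => B i.+1) k') else unitg.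

Fixpoint prodn_pr (B : nat -> Grp) (k i : nat) : prodn B k -> B i :=
  match k return prodn B k -> B i with
  | 0 => fun _ => 1
  | k'.+1 => match i return prodn B k'.+1 -> B i with
             | 0 => fun g => g.1
             | i'.+1 => fun g => @prodn_pr (fun i => B i.+1) k' i' g.2
             end
  end.

Fixpoint prodn_inj (B : nat -> Grp) (k i : nat) : B i -> prodn B k :=
  match k return B i -> prodn B k with
  | 0 => fun _ => tt
  | k'.+1 => match i return B i -> prodn B k'.+1 with
             | 0 => fun x => (x, 1)
             | i'.+1 => fun x => (1, @prodn_inj (fun i => B i.+1) k' i' x)
             end
  end.

Lemma prodn_direct (B : nat -> Grp) (k : nat) :
  direct_decomposition k (@prodn_inj B k) (@prodn_pr B k).
Proof.
elim: k B => [|k IH] B.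
  split=> //; first by move=> i x y; rewrite /= gmul1.
  by case; case.
have D := IH (fun i => B i.+1); split.
- case=> [|i] x y /=; congr pair; rewrite ?gmul1 //.
  by rewrite (injM D).
- by case=> [|i] // x y; apply: (prM D).
- by case=> [|i] //= x h; apply: (pr_inj D x h).
- move=> [|i] [|j] x //= n; first exact: (pr1 D).
  by apply: (pr_inj1 D) => e; apply: n; rewrite e.
- move=> [x1 x2] [y1 y2] H; congr pair; first exact: (H 0%N).
  by apply: (pr_ext D) => i h; apply: (H i.+1).
Qed.

(** * The involution exchanging conjugations with partial conjugations *)

Lemma coproduct_ext (G1 G2 A H : Grp) (e1 : G1 -> A) (e2 : G2 -> A)
    (F F' : A -> H) :
  coproduct e1 e2 -> is_hom F -> is_hom F' ->
  (forall x, F (e1 x) = F' (e1 x)) -> (forall y, F (e2 y) = F' (e2 y)) -> F =1 F'.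
Proof.
move=> [_ _ _ gen] FM F'M h1 h2; apply: gen => // a c ha hc.
by rewrite FM F'M ha hc.
Qed.

(* If [A = (B x D) * G2], every [b : B] acts on [A] in two commuting ways:
   by conjugation, and by conjugation of the free factor [G2] only. The
   automorphism [swap] of [Aut A] exchanges the two (up to an inversion). It
   fixes every automorphism of [A] which preserves [B], [D] and [G2]. *)
Section Swap.
Variables (G1 G2 A : Grp) (e1 : G1 -> A) (e2 : G2 -> A).
Hypothesis C : coproduct e1 e2.
Variable pi : G1 -> G1.
Hypotheses (piM : is_hom pi) (pi_idem : forall x, pi (pi x) = pi x).

(** The projection onto [D] complementary to [pi], whose image is [B]. An idempotent [pi] with
    [pi_copi] encodes the decomposition [B x D] inside [G1]. *)
Definition copi x := (pi x)^-1 * x.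

Hypothesis pi_copi : forall x y, commute (pi x) (copi y).

Implicit Types (g x : G1) (y : G2) (a c : A).

Definition adapted (psi : automorphism A) := exists (f1 : G1 -> G1) (f2 : G2 -> G2),
  [/\ is_hom f1, forall x, psi (e1 x) = e1 (f1 x),
      forall y, psi (e2 y) = e2 (f2 y) & forall x, f1 (pi x) = pi (f1 x)].

Hypothesis adapted_ex : forall phi : automorphism A,
  exists c psi, adapted psi /\ phi = aut_mul (ad c) psi.
Hypothesis adapted_uniq : forall c c' psi psi', adapted psi -> adapted psi' ->
  aut_mul (ad c) psi = aut_mul (ad c') psi' -> c = c'.

Lemma e1M : is_hom e1. Proof. by case: C. Qed.
Lemma e2M : is_hom e2. Proof. by case: C. Qed.

Lemma copiM : is_hom copi.
Proof.
move=> x y; rewrite /copi piM invMg -gmulA (gmulA _ x) -/(copi x).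
rewrite gmulA -(commuteV (commute_sym (pi_copi y x))) -!gmulA.
by congr gmul; rewrite gmulA.
Qed.

Lemma pi_copi1 x : pi (copi x) = 1.
Proof. by rewrite /copi piM (homV piM) pi_idem gmulV. Qed.

Lemma copi_pi1 x : copi (pi x) = 1.
Proof. by rewrite /copi pi_idem gmulV. Qed.

Lemma copi_idem x : copi (copi x) = copi x.
Proof. by rewrite /copi -/(copi x) pi_copi1 invg1 gmul1. Qed.

Lemma pi_mul_copi x : pi x * copi x = x. Proof. exact: mulKVg. Qed.

(** Inverts the [B]-component and keeps the [D]-component. It is only a crossed homomorphism, and
    [sgnM] is exactly the cocycle rule that makes [twist_fun] multiplicative. *)
Definition sgn g := copi g * (pi g)^-1.

Lemma sgnM g h : sgn (g * h) = conjg (copi g) (sgn h) * sgn g.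
Proof.
rewrite /sgn /conjg copiM piM; move: (copi g) (copi h) => u v.
by rewrite invMg -!gmulA mulKg.
Qed.

Lemma copi_sgn g : copi (sgn g) = copi g.
Proof. by rewrite /sgn copiM (homV copiM) copi_pi1 invg1 mulg1 copi_idem. Qed.

Lemma pi_sgn g : pi (sgn g) = (pi g)^-1.
Proof. by rewrite /sgn piM (homV piM) pi_copi1 gmul1 pi_idem. Qed.

Lemma sgnK g : sgn (sgn g) = g.
Proof. by rewrite {1}/sgn copi_sgn pi_sgn invgK -pi_copi pi_mul_copi. Qed.

Lemma sgn1 : sgn 1 = 1.
Proof. by rewrite /sgn (hom1 copiM) (hom1 piM) invg1 gmul1. Qed.

(** The intended image of conjugation by [e1 g]: the [D]-part acts by honest conjugation, while the
    [B]-part acts on [G2] alone and inverted. *)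
Lemma twist_fun_ex g : exists F : A -> A, [/\ is_hom F,
  forall x, F (e1 x) = e1 (conjg (copi g) x)
  & forall y, F (e2 y) = conjg (e1 (sgn g)) (e2 y)].
Proof.
have [_ _ U _] := C.
have [||F [FM F1 F2]] := U A (e1 \o conjg (copi g)) (conjg (e1 (sgn g)) \o e2).
- by apply: is_hom_comp; [exact: e1M | exact: conjgM].
- by apply: is_hom_comp; [exact: conjgM | exact: e2M].
by exists F; split.
Qed.

Definition twist_fun g := sval (cid (twist_fun_ex g)).

Lemma twist_funP g : [/\ is_hom (twist_fun g),
  forall x, twist_fun g (e1 x) = e1 (conjg (copi g) x)
  & forall y, twist_fun g (e2 y) = conjg (e1 (sgn g)) (e2 y)].
Proof. by rewrite /twist_fun; case: cid. Qed.

Lemma twist_fun_hom g : is_hom (twist_fun g). Proof. by case: (twist_funP g). Qed.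
Lemma twist_fun1 g x : twist_fun g (e1 x) = e1 (conjg (copi g) x).
Proof. by case: (twist_funP g). Qed.
Lemma twist_fun2 g y : twist_fun g (e2 y) = conjg (e1 (sgn g)) (e2 y).
Proof. by case: (twist_funP g). Qed.

Lemma twist_funM g h a : twist_fun (g * h) a = twist_fun g (twist_fun h a).
Proof.
apply: (coproduct_ext C (F' := twist_fun g \o twist_fun h)) => [| |x|y] /=.
- exact: twist_fun_hom.
- by apply: is_hom_comp; exact: twist_fun_hom.
- by rewrite !twist_fun1 copiM conjMg.
- rewrite !twist_fun2 (hom_conjg (@twist_fun_hom g)) twist_fun1 twist_fun2.
  by rewrite -conjMg -e1M sgnM.
Qed.

Lemma twist_fun_one a : twist_fun 1 a = a.
Proof.
apply: (coproduct_ext C (F' := id)) => // [|x|y].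
- exact: twist_fun_hom.
- by rewrite twist_fun1 (hom1 copiM) conj1g.
- by rewrite twist_fun2 sgn1 (hom1 e1M) conj1g.
Qed.

Lemma twist_funK g : cancel (twist_fun g) (twist_fun g^-1).
Proof. by move=> a; rewrite -twist_funM gmulV twist_fun_one. Qed.
Lemma twist_funKV g : cancel (twist_fun g^-1) (twist_fun g).
Proof. by move=> a; rewrite -twist_funM mulgV twist_fun_one. Qed.

Definition twist1 g : Aut A :=
  Automorphism (@twist_fun_hom g) (@twist_funK g) (@twist_funKV g).

(** The universal property is applied with target [Aut A]; the result prescribes the exchange on
    inner automorphisms. *)
Lemma twist_ex : exists F : A -> Aut A, [/\ is_hom F,
  forall g, F (e1 g) = twist1 g & forall y, F (e2 y) = ad (e2 y)].
Proof.
have [_ _ U _] := C.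
have [||F [FM F1 F2]] := U (Aut A) twist1 (fun y => ad (e2 y) : Aut A).
- by move=> g h; apply: aut_ext => a; exact: twist_funM.
- by move=> y y'; rewrite e2M; exact: adM.
by exists F; split.
Qed.

Definition twist : A -> Aut A := sval (cid twist_ex).

Lemma twistP : [/\ is_hom twist,
  forall g, twist (e1 g) = twist1 g & forall y, twist (e2 y) = ad (e2 y)].
Proof. by rewrite /twist; case: cid. Qed.

Lemma twistM : is_hom twist. Proof. by case: twistP. Qed.
Lemma twist_e1 g : twist (e1 g) = twist1 g. Proof. by case: twistP. Qed.
Lemma twist_e2 y : twist (e2 y) = ad (e2 y). Proof. by case: twistP. Qed.

(** The compatibility needed to extend [twist] by the identity over the semidirect product. It holds
    because adapted maps commute with [pi], hence with [copi] and [sgn]. *)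
Lemma twist_equivariant (psi : Aut A) a : adapted psi ->
  twist ((psi : automorphism A) a) = psi * twist a * psi^-1.
Proof.
move=> [f1 [f2 [f1M h1 h2 hpi]]].
have f1_copi x : f1 (copi x) = copi (f1 x) by rewrite /copi f1M (homV f1M) hpi.
have f1_sgn x : f1 (sgn x) = sgn (f1 x).
  by rewrite /sgn f1M (homV f1M) hpi f1_copi.
apply: (coproduct_ext C (F := twist \o (psi : automorphism A))
         (F' := fun a => psi * twist a * psi^-1)) => [| |g|y].
- by apply: is_hom_comp; [exact: twistM | exact: is_hom_aut].
- by move=> c c'; rewrite twistM; exact: (conjgM psi).
- rewrite /= h1 !twist_e1; apply: (@mulIg _ psi); rewrite mulgKV.
  apply: aut_ext; apply: (coproduct_ext C) => [| |x|y].
  + exact: (is_hom_aut (aut_mul (twist1 (f1 g)) psi)).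
  + exact: (is_hom_aut (aut_mul psi (twist1 g))).
  + rewrite /= h1 !twist_fun1 h1; congr e1.
    by rewrite (hom_conjg f1M) f1_copi.
  + rewrite /= h2 !twist_fun2 (hom_conjg (@is_hom_aut _ psi)) h1 h2.
    by rewrite f1_sgn.
- rewrite /= h2 !twist_e2 -h2; apply: aut_ext => x /=.
  change (conjg (psi (e2 y)) x = psi (conjg (e2 y) (ainv psi x))).
  by rewrite (hom_conjg (@is_hom_aut _ psi)) ainvK.
Qed.

Lemma decomposition_ex (phi : Aut A) :
  exists p : A * Aut A, adapted p.2 /\ phi = (ad p.1 : Aut A) * p.2.
Proof. by have [c [psi []]] := adapted_ex phi; exists (c, psi). Qed.

Definition decomposition phi := sval (cid (decomposition_ex phi)).

Definition swap_fun (phi : Aut A) : Aut A :=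
  twist (decomposition phi).1 * (decomposition phi).2.

(** The decomposition picked by choice is harmless: [c] is unique by [adapted_uniq], and [psi]
    follows by cancellation. *)
Lemma swap_funE c (psi : Aut A) :
  adapted psi -> swap_fun ((ad c : Aut A) * psi) = twist c * psi.
Proof.
move=> h; rewrite /swap_fun /decomposition; case: cid => -[c' psi'] /= [h' e].
have ec := adapted_uniq h h' e; subst c'.
by rewrite (@mulgI (Aut A) _ _ _ e).
Qed.

Lemma adaptedM (psi psi' : Aut A) : adapted psi -> adapted psi' ->
  adapted (psi * psi').
Proof.
move=> [f1 [f2 [f1M h1 h2 h3]]] [f1' [f2' [f1M' h1' h2' h3']]].
exists (f1 \o f1'), (f2 \o f2'); split=> [|x|x|x] /=.
- exact: is_hom_comp.
- by rewrite h1' h1.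
- by rewrite h2' h2.
- by rewrite h3' h3.
Qed.

Lemma adapted1 : adapted (1 : Aut A).
Proof. by exists id, id; split. Qed.

Lemma swap_fun_ad c : swap_fun (ad c : Aut A) = twist c.
Proof. by rewrite -[ad c in LHS](@mulg1 (Aut A)) swap_funE ?mulg1 //; apply: adapted1. Qed.

Lemma swap_fun_hom : is_hom swap_fun.
Proof.
move=> phi phi'.
have [c [psi [h ->]]] := adapted_ex phi.
have [c' [psi' [h' ->]]] := adapted_ex phi'.
rewrite !swap_funE //.
have -> : (aut_mul (ad c) psi : Aut A) * aut_mul (ad c') psi' =
    (ad (c * psi c') : Aut A) * ((psi : Aut A) * psi').
  apply: aut_ext => x; rewrite /= conjMg.
  by rewrite (hom_conjg (@is_hom_aut _ psi)).
rewrite swap_funE; last exact: adaptedM.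
rewrite twistM twist_equivariant // -!gmulA; congr gmul.
by rewrite mulKg.
Qed.

Lemma swap_fun_twist a : swap_fun (twist a) = ad a.
Proof.
apply: (coproduct_ext C (F := swap_fun \o twist) (F' := fun a => ad a : Aut A))
  => [| |g|y] /=.
- by apply: is_hom_comp; [exact: swap_fun_hom | exact: twistM].
- exact: adM.
(* Removing from [twist1 g] its effect on [G2] leaves [tau], conjugation of [G1] alone by [pi g]. It
   is adapted, so the exchange turns [twist1 g] into [twist1 (sgn g) * tau], which acts by [g] on
   both factors. *)
- rewrite twist_e1; pose tau : Aut A := (ad (e1 (sgn g)) : Aut A)^-1 * twist1 g.
  have tau1 x : (tau : automorphism A) (e1 x) = e1 (conjg (pi g) x).
    change (conjg (e1 (sgn g))^-1 (twist_fun g (e1 x)) = e1 (conjg (pi g) x)).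
    rewrite twist_fun1 -(homV e1M) -(hom_conjg e1M) -conjMg; congr (e1 (conjg _ _)).
    by rewrite /sgn invMg invgK mulgKV.
  have tau2 y : (tau : automorphism A) (e2 y) = e2 y.
    change (conjg (e1 (sgn g))^-1 (twist_fun g (e2 y)) = e2 y).
    by rewrite twist_fun2 conjgK.
  have tau_adapted : adapted tau.
    exists (conjg (pi g)), id; split=> //; first exact: conjgM.
    by move=> x; rewrite (hom_conjg piM) pi_idem.
  have -> : twist1 g = (ad (e1 (sgn g)) : Aut A) * tau by rewrite mulKVg.
  rewrite swap_funE // twist_e1; apply: aut_ext.
  apply: (coproduct_ext C) => [| |x|y].
  + exact: (is_hom_aut (aut_mul (twist1 (sgn g)) tau)).
  + exact: conjgM.
  + change (twist_fun (sgn g) ((tau : automorphism A) (e1 x)) = conjg (e1 g) (e1 x)).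
    rewrite tau1 twist_fun1 copi_sgn -conjMg -pi_copi pi_mul_copi.
    by rewrite (hom_conjg e1M).
  + change (twist_fun (sgn g) ((tau : automorphism A) (e2 y)) = conjg (e1 g) (e2 y)).
    by rewrite tau2 twist_fun2 sgnK.
- by rewrite twist_e2 swap_fun_ad twist_e2.
Qed.

Lemma swap_funK : cancel swap_fun swap_fun.
Proof.
move=> phi; have [c [psi [h ->]]] := adapted_ex phi.
rewrite swap_funE // swap_fun_hom swap_fun_twist.
have -> : swap_fun psi = psi; last by [].
rewrite -[psi in LHS](@gmul1 (Aut A)).
have -> : (1 : Aut A) = ad (1 : A) by apply: aut_ext => x /=; rewrite conj1g.
by rewrite swap_funE // (hom1 twistM) gmul1.
Qed.

Definition swap : automorphism (Aut A) := Automorphism swap_fun_hom swap_funK swap_funK.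

Lemma swapE (phi : Aut A) : swap phi = swap_fun phi. Proof. by []. Qed.

Lemma swap_ad_fixed g : pi g = 1 -> swap (ad (e1 g)) = ad (e1 g).
Proof.
move=> e; have eg : copi g = g by rewrite /copi e invg1 gmul1.
rewrite swapE swap_fun_ad twist_e1; apply: aut_ext.
apply: (coproduct_ext C) => [| |x|y]; [exact: twist_fun_hom | exact: conjgM | |].
  by rewrite /= twist_fun1 eg (hom_conjg e1M).
by rewrite /= twist_fun2 /sgn eg e invg1 mulg1.
Qed.

(** Detects that [swap] moves inner automorphisms: an inner one that is trivial on all of [G1] would
    be the identity in the application. *)
Lemma swap_ad_e1 g x : pi g = g -> (swap (ad (e1 g)) : automorphism A) (e1 x) = e1 x.
Proof.
move=> e; rewrite swapE swap_fun_ad twist_e1 /= twist_fun1.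
by rewrite /copi e gmulV conj1g.
Qed.

(** Only [ad c] is replaced, by [twist c], and both merely conjugate generators, which an abelian
    target cannot see. *)
Lemma swap_abelian (H : Grp) (chi : A -> H) (phi : automorphism A) a :
  (forall x y : H, commute x y) -> is_hom chi ->
  chi ((swap phi : automorphism A) a) = chi (phi a).
Proof.
move=> ab chiM.
have chi_conjg c b : chi (conjg c b) = chi b.
  by rewrite (hom_conjg chiM) conjg_fix.
have chi_twist c b : chi ((twist c : automorphism A) b) = chi b.
  have [_ _ _ gen] := C; move: c b; apply: gen => [g|y|c c' h h'] b.
  - rewrite twist_e1; apply: (coproduct_ext C (F := chi \o twist_fun g)) => // [|x|y] /=.
    + by apply: is_hom_comp => //; exact: twist_fun_hom.
    + by rewrite twist_fun1 (hom_conjg e1M) chi_conjg.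
    + by rewrite twist_fun2 chi_conjg.
  - by rewrite twist_e2 /= chi_conjg.
  - by rewrite twistM /= h h'.
have [c [psi [h ->]]] := adapted_ex phi.
by rewrite swapE swap_funE //= chi_twist chi_conjg.
Qed.

End Swap.

(** * Presentations of right-angled Artin groups *)

(** As for [coproduct], generation by induction stands in for uniqueness of the extension. *)
Definition presents (T : finType) (e : rel T) (G : Grp) (v : T -> G) : Prop :=
  [/\ forall x y, e x y -> commute (v x) (v y),
      forall (H : Grp) (f : T -> H), (forall x y, e x y -> commute (f x) (f y)) ->
        exists2 F : G -> H, is_hom F & forall x, F (v x) = f x
    & forall P : G -> Prop, P 1 -> (forall x, P (v x)) -> (forall a, P a -> P a^-1) ->
        (forall a c, P a -> P c -> P (a * c)) -> forall a, P a].

Lemma presents_ext (T : finType) (e : rel T) (G H : Grp) (v : T -> G) (F F' : G -> H) :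
  presents e v -> is_hom F -> is_hom F' -> (forall x, F (v x) = F' (v x)) -> F =1 F'.
Proof.
move=> [_ _ gen] FM F'M E; apply: gen => // [|a h|a c h h'].
- by rewrite (hom1 FM) (hom1 F'M).
- by rewrite (homV FM) (homV F'M) h.
- by rewrite FM F'M h h'.
Qed.

Lemma presents_commute (T : finType) (e : rel T) (G H : Grp) (v : T -> G)
    (F : G -> H) h :
  presents e v -> is_hom F -> (forall x, commute h (F (v x))) ->
  forall a, commute h (F a).
Proof.
move=> [_ _ gen] FM E; apply: gen => // [|a ha|a c ha hc].
- by rewrite (hom1 FM); apply: commute1.
- by rewrite (homV FM); apply: commuteV.
- by rewrite FM; apply: commuteM.
Qed.

Lemma presents_isomorphic (T : finType) (e : rel T) (G H : Grp)
    (v : T -> G) (w : T -> H) :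
  presents e v -> presents e w -> isomorphic G H.
Proof.
move=> pG pH; have [cG uG _] := pG; have [cH uH _] := pH.
have [F FM Fv] := uG H w cH; have [F' F'M F'w] := uH G v cG.
exists F, F'; split=> //.
  apply: (presents_ext (F := F' \o F) (F' := id) pG) => // [|x /=].
    exact: is_hom_comp.
  by rewrite Fv F'w.
apply: (presents_ext (F := F \o F') (F' := id) pH) => // [|x /=].
  exact: is_hom_comp.
by rewrite F'w Fv.
Qed.

Section RaagPresentation.
Variables (T : finType) (e : rel T).

Definition generator (x : T) : raag e := cls e [:: (x, true)].

Lemma clsM (u w : word T) : (cls e u : raag e) * cls e w = cls e (u ++ w).
Proof. by apply: clsE; apply: rr_cat; apply: rep_cls. Qed.

Lemma cls_nil : cls e [::] = (1 : raag e). Proof. by []. Qed.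

Lemma cls_false x : cls e [:: (x, false)] = (generator x)^-1.
Proof.
apply: (@invg_uniq (raag e)); rewrite /generator clsM -cls_nil; apply: clsE.
exact: (rr_free e x true).
Qed.

Section Eval.
Variables (H : Grp) (f : T -> H).
Hypothesis fC : forall x y, e x y -> commute (f x) (f y).

Definition eval (w : word T) : H :=
  foldr (fun l (h : H) => (if l.2 then f l.1 else (f l.1)^-1) * h) 1 w.

Lemma eval_cat u w : eval (u ++ w) = eval u * eval w.
Proof. by elim: u => [|l u IH] /=; rewrite ?gmul1 // IH gmulA. Qed.

Lemma eval_rel u w : raag_rel e u w -> eval u = eval w.
Proof.
elim=> // {u w} [u v w _ -> _ ->|a b u v _ E|x s|x y /fC exy] //.
- by rewrite !eval_cat E.
- by case: s; rewrite /= mulg1 ?mulgV ?gmulV.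
- by rewrite /= mulg1 !gmulA exy mulgK mulgV.
Qed.

End Eval.

Lemma raag_presents : presents e generator.
Proof.
split=> [x y exy|H f fC|P P1 Pv PV PM a].
- have := clsE (rr_comm exy); rewrite cls_nil.
  rewrite -(cat1s (x, true)) -(cat1s (y, true)) -(cat1s (x, false)) -!clsM !cls_false.
  rewrite !gmulA => E; apply: (@mulIg _ (generator x)^-1); rewrite mulgK.
  by apply: (@mulIg _ (generator y)^-1); rewrite E mulgV.
- exists (fun q => eval f (rep q)) => [p q|x].
    by rewrite (eval_rel fC (rep_cls e _)) eval_cat.
  by rewrite (eval_rel fC (rep_cls e _)) /= mulg1.
- rewrite -(clsK a); elim: (rep a) => // -[x s] w IH.
  rewrite -cat1s -clsM; apply: PM => //; case: s; first exact: Pv.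
  by rewrite cls_false; apply: PV; apply: Pv.
Qed.

End RaagPresentation.

(** Arbitrary finite vertex types let graphs be combined on sum types; renumbering by ['I_n] is done
    once, in [is_raag_raag]. *)
Definition is_raag (n : nat) (G : Grp) := exists (T : finType) (e : rel T) (v : T -> G),
  [/\ #|T| = n, symmetric e, irreflexive e & presents e v].

Lemma is_raag_raag (n : nat) (G : Grp) : is_raag n G ->
  exists e : rel 'I_n, simplicial e /\ isomorphic (raag e) G.
Proof.
move=> [T [e [v [cT es ei pv]]]]; subst n.
exists (fun i j => e (enum_val i) (enum_val j)); split.
  by split=> [i j|i]; [apply: es | apply: ei].
apply: (presents_isomorphic (w := v \o enum_val) (raag_presents _)).
have [vC U gen] := pv; split=> [i j|H f fC|P P1 Pv PV PM].
- exact: vC.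
- have [|F FM Fv] := U H (f \o enum_rank).
    by move=> x y exy; apply: fC; rewrite !enum_rankK.
  by exists F => // i; rewrite /= Fv /= enum_valK.
- by apply: gen => // x; rewrite -(enum_rankK x); apply: Pv.
Qed.

(** * Closure of right-angled Artin groups under free and direct products *)

Lemma is_raag_unit : is_raag 0 unitg.
Proof.
exists void, (fun _ _ => false), (fun x : void => match x with end).
split=> //; first by rewrite card_void.
split=> [[]|H f _|P P1 _ _ _ []] //.
by exists (fun _ => 1) => [x y|[]]; rewrite gmul1.
Qed.

Definition intg : Grp := raag (fun _ _ : unit => false).

Lemma is_raag_intg : is_raag 1 intg.
Proof.
exists unit, (fun _ _ => false), (@generator _ _); split=> //.
  by rewrite card_unit.
exact: raag_presents.
Qed.

Section SumRelation.
Variables (T1 T2 : finType) (r : bool) (e1 : rel T1) (e2 : rel T2).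

(** For [r = false] this is the disjoint union of graphs, giving free products; for [r = true] it is
    the join, giving direct products. *)
Definition sum_rel (x y : T1 + T2) : bool :=
  match x, y with
  | inl a, inl b => e1 a b
  | inr a, inr b => e2 a b
  | _, _ => r
  end.

Lemma sum_rel_sym : symmetric e1 -> symmetric e2 -> symmetric sum_rel.
Proof. by move=> h1 h2 [a|a] [b|b] //=. Qed.

Lemma sum_rel_irr : irreflexive e1 -> irreflexive e2 -> irreflexive sum_rel.
Proof. by move=> h1 h2 [a|a] /=. Qed.

End SumRelation.

Lemma is_raag_freeprod n1 n2 (G1 G2 : Grp) :
  is_raag n1 G1 -> is_raag n2 G2 -> is_raag (n1 + n2) (freeprod G1 G2).
Proof.
move=> [T1 [e1 [v1 [c1 s1 i1 p1]]]] [T2 [e2 [v2 [c2 s2 i2 p2]]]].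
pose v (x : T1 + T2) : freeprod G1 G2 :=
  match x with inl a => in1 G2 (v1 a) | inr a => in2 G1 (v2 a) end.
exists (T1 + T2)%type, (sum_rel false e1 e2), v; split.
- by rewrite card_sum c1 c2.
- exact: sum_rel_sym.
- exact: sum_rel_irr.
have [v1C U1 gen1] := p1; have [v2C U2 gen2] := p2.
have [i1M i2M U gen] := @freeprod_coproduct G1 G2.
split=> [[a|a] [b|b] //=|H f fC|P P1 Pv PV PM].
- by move/v1C; apply: (hom_commute i1M).
- by move/v2C; apply: (hom_commute i2M).
- have [|F1 F1M F1v] := U1 H (f \o inl); first by move=> x y h; apply: fC.
  have [|F2 F2M F2v] := U2 H (f \o inr); first by move=> x y h; apply: fC.
  have [F [FM h1 h2]] := U H F1 F2 F1M F2M.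
  exists F => // -[a|a] /=.
    exact: etrans (h1 _) (F1v _).
  exact: etrans (h2 _) (F2v _).
- apply: gen => //.
    apply: gen1 => [|x|a h|a c h h'].
    + by rewrite (hom1 i1M).
    + exact: (Pv (inl x)).
    + by rewrite (homV i1M); apply: PV.
    + by rewrite i1M; apply: PM.
  apply: gen2 => [|x|a h|a c h h'].
  + by rewrite (hom1 i2M).
  + exact: (Pv (inr x)).
  + by rewrite (homV i2M); apply: PV.
  + by rewrite i2M; apply: PM.
Qed.

Definition pin1 (G1 G2 : Grp) (x : G1) : prodg G1 G2 := (x, 1).
Definition pin2 (G1 G2 : Grp) (y : G2) : prodg G1 G2 := (1, y).

Lemma pin1M (G1 G2 : Grp) : is_hom (@pin1 G1 G2).
Proof. by move=> x y; congr pair; rewrite gmul1. Qed.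

Lemma pin2M (G1 G2 : Grp) : is_hom (@pin2 G1 G2).
Proof. by move=> x y; congr pair; rewrite gmul1. Qed.

Lemma pin_commute (G1 G2 : Grp) (x : G1) (y : G2) : commute (pin1 G2 x) (pin2 G1 y).
Proof. by congr pair; rewrite gmul1 mulg1. Qed.

Lemma pin_mul (G1 G2 : Grp) (p : prodg G1 G2) : p = pin1 G2 p.1 * pin2 G1 p.2.
Proof. by case: p => x y; congr pair; rewrite ?gmul1 ?mulg1. Qed.

Lemma is_raag_prodg n1 n2 (G1 G2 : Grp) :
  is_raag n1 G1 -> is_raag n2 G2 -> is_raag (n1 + n2) (prodg G1 G2).
Proof.
move=> [T1 [e1 [v1 [c1 s1 i1 p1]]]] [T2 [e2 [v2 [c2 s2 i2 p2]]]].
pose v (x : T1 + T2) : prodg G1 G2 :=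
  match x with inl a => pin1 G2 (v1 a) | inr a => pin2 G1 (v2 a) end.
exists (T1 + T2)%type, (sum_rel true e1 e2), v; split.
- by rewrite card_sum c1 c2.
- exact: sum_rel_sym.
- exact: sum_rel_irr.
have [v1C U1 gen1] := p1; have [v2C U2 gen2] := p2.
split=> [[a|a] [b|b] //=|H f fC|P P1 Pv PV PM p].
- by move/v1C; apply: (hom_commute (@pin1M _ _)).
- by move=> _; apply: pin_commute.
- by move=> _; apply/commute_sym/pin_commute.
- by move/v2C; apply: (hom_commute (@pin2M _ _)).
- have [|F1 F1M F1v] := U1 H (f \o inl); first by move=> x y h; apply: fC.
  have [|F2 F2M F2v] := U2 H (f \o inr); first by move=> x y h; apply: fC.
  have F12 x y : commute (F1 x) (F2 y).
    apply: (presents_commute p2 F2M) => b; apply: commute_sym.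
    apply: (presents_commute p1 F1M) => a; apply: commute_sym.
    by rewrite F1v F2v; apply: fC.
  exists (fun p => F1 p.1 * F2 p.2) => [p q|[a|a]] /=.
  + rewrite [F1 _]F1M [F2 _]F2M -!gmulA; congr gmul.
    by rewrite !gmulA F12.
  + by rewrite F1v (hom1 F2M) mulg1.
  + by rewrite F2v (hom1 F1M) gmul1.
- rewrite (pin_mul p); apply: (PM _ _).
    move: p.1; apply: gen1 => [|x|a h|a c h h'].
    + exact: P1.
    + exact: (Pv (inl x)).
    + by rewrite (homV (@pin1M _ _)); apply: PV.
    + by rewrite pin1M; apply: PM.
  move: p.2; apply: gen2 => [|x|a h|a c h h'].
  + exact: P1.
  + exact: (Pv (inr x)).
  + by rewrite (homV (@pin2M _ _)); apply: PV.
  + by rewrite pin2M; apply: PM.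
Qed.

Lemma is_raag_prodn (B : nat -> Grp) k :
  (forall i, exists n, is_raag n (B i)) -> exists n, is_raag n (prodn B k).
Proof.
elim: k B => [|k IH] B h; first by exists 0%N; exact: is_raag_unit.
have [n hn] := IH (fun i => B i.+1) (fun i => h i.+1).
by have [m hm] := h 0%N; exists (m + n)%N; apply: is_raag_prodg.
Qed.

(** * Invariance of the number of generators; free groups *)

Lemma addbV (b : bool) : b (+) b = false. Proof. exact: addbb. Qed.

Definition boolg : Grp := MkGrp addbA addFb addbV.

Lemma boolg_commute (x y : boolg) : commute x y. Proof. exact: addbC. Qed.

(** Count homomorphisms to the group of order 2: every function on the [m] generators of [G] extends
    to one, and it is determined by its values on the [n] generators transported from [H], so
    [2^m <= 2^n]. *)
Lemma is_raag_leq m n (G H : Grp) :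
  is_raag m G -> is_raag n H -> isomorphic G H -> (m <= n)%N.
Proof.
move=> [T [e [v [<- _ _ pv]]]] [T' [e' [v' [<- _ _ pv']]]] [f [g [fM fK gK]]].
have gM : is_hom g by move=> x y; rewrite -{1}(gK x) -{1}(gK y) -fM fK.
have [_ U _] := pv.
have X (c : {ffun T -> bool}) :
    exists F : G -> boolg, is_hom F /\ forall x, F (v x) = c x.
  have [|F FM Fv] := U boolg (c : T -> boolg); last by exists F.
  by move=> x y _; apply: boolg_commute.
pose F c := sval (cid (X c)).
have [FM Fv] : (forall c, is_hom (F c)) /\ (forall c x, F c (v x) = c x).
  by split=> c; rewrite /F; case: cid => ? [].
pose r (c : {ffun T -> bool}) : {ffun T' -> bool} := [ffun y => F c (g (v' y))].
have rI : injective r.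
  move=> c c' E; apply/ffunP => x; rewrite -!Fv -(fK (v x)).
  apply: (presents_ext (F := F c \o g) (F' := F c' \o g) pv').
  - exact: is_hom_comp.
  - exact: is_hom_comp.
  - by move=> y; move/ffunP/(_ y): E; rewrite !ffunE.
have := leq_card r rI; rewrite !card_ffun card_bool.
by rewrite leq_exp2l.
Qed.

Lemma isomorphic_sym (G H : Grp) : isomorphic G H -> isomorphic H G.
Proof.
move=> [f [g [fM fK gK]]]; exists g, f; split=> // x y.
by rewrite -{1}(gK x) -{1}(gK y) -fM fK.
Qed.

Lemma is_raag_uniq m n (G H : Grp) :
  is_raag m G -> is_raag n H -> isomorphic G H -> m = n.
Proof.
move=> hG hH i; apply/eqP; rewrite eqn_leq (is_raag_leq hG hH i).
exact: (is_raag_leq hH hG (isomorphic_sym i)).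
Qed.

Lemma is_raag_nontrivial n (G : Grp) : is_raag n.+1 G -> exists x : G, x <> 1.
Proof.
move=> [T [e [v [c _ _ [_ U _]]]]].
have /card_gt0P[x _] : (0 < #|T|)%N by rewrite c.
have [|F FM Fv] := U boolg (fun _ => true); first by move=> *; apply: boolg_commute.
by exists (v x) => E; have := Fv x; rewrite E (hom1 FM).
Qed.

Lemma intg_commute (x y : intg) : commute x y.
Proof.
have p := raag_presents (fun _ _ : unit => false).
apply: (presents_commute (F := id) p) => // -[]; apply: commute_sym.
by apply: (presents_commute (F := id) p) => // -[].
Qed.

Fixpoint freeg (n : nat) : Grp := if n is n'.+1 then freeprod intg (freeg n') else unitg.

Lemma is_raag_freeg n : is_raag n (freeg n).
Proof.
elim: n => [|n IH]; first exact: is_raag_unit.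
exact: (is_raag_freeprod is_raag_intg IH).
Qed.

Lemma freeg_commutative_transitive n : commutative_transitive (freeg n).
Proof.
elim: n => [|n IH]; first by case.
by apply: freeprod_commutative_transitive => // x y z _ _ _; apply: intg_commute.
Qed.

Lemma freeprod_nonabelian (G1 G2 : Grp) :
  (exists x : G1, x <> 1) -> (exists y : G2, y <> 1) -> nonabelian (freeprod G1 G2).
Proof.
move=> [x nx] [y ny]; exists (in1 G2 x), (in2 G1 y) => E.
have nx' : in1 G2 x <> 1 by rewrite -(hom1 (@in1_hom G1 G2)) => /in1_inj.
apply: ny; apply: (@in2_inj G1); rewrite (hom1 (@in2_hom _ _)).
apply: inF_both; last exact: inF_in2.
exact: (@centralizer_factor _ _ true _ _ (inF_in1 _ _) nx' E).
Qed.

Lemma freeg_nonabelian n : nonabelian (freeg n.+2).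
Proof.
apply: freeprod_nonabelian; first exact: is_raag_nontrivial is_raag_intg.
exact: is_raag_nontrivial (is_raag_freeg n.+1).
Qed.

(** * Transport along isomorphisms *)

Section Transport.
Variables (G H : Grp) (f : G -> H) (g : H -> G).
Hypotheses (fM : is_hom f) (gM : is_hom g) (fK : cancel f g) (gK : cancel g f).

Lemma transport_hom (phi : automorphism G) : is_hom (f \o phi \o g).
Proof. by move=> x y /=; rewrite gM afunM fM. Qed.

Lemma transportK (phi : automorphism G) :
  cancel (f \o phi \o g) (f \o ainv phi \o g).
Proof. by move=> x /=; rewrite fK afunK gK. Qed.

Lemma transportKV (phi : automorphism G) :
  cancel (f \o ainv phi \o g) (f \o phi \o g).
Proof. by move=> x /=; rewrite fK ainvK gK. Qed.

Definition transport (phi : automorphism G) : automorphism H :=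
  Automorphism (@transport_hom phi) (@transportK phi) (@transportKV phi).

Lemma transportM (phi psi : automorphism G) :
  transport (aut_mul phi psi) = aut_mul (transport phi) (transport psi).
Proof. by apply: aut_ext => x /=; rewrite fK. Qed.

Lemma transportV (phi : automorphism G) :
  transport (aut_inv phi) = aut_inv (transport phi).
Proof. exact: aut_ext. Qed.

Lemma inner_transport (phi : automorphism G) : inner (transport phi) -> inner phi.
Proof.
move=> [h E]; exists (g h) => x; rewrite -(homV gM) -{2}(fK x) -!gM -E.
by rewrite /= !fK.
Qed.

End Transport.

Lemma isomorphic_Aut (G H : Grp) : isomorphic G H -> isomorphic (Aut G) (Aut H).
Proof.
move=> i; have [g [f [gM _ _]]] := isomorphic_sym i.
move: i => [f' [g' [fM fK gK]]].
have gM' : is_hom g' by move=> x y; rewrite -{1}(gK x) -{1}(gK y) -fM fK.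
exists (transport fM gM' fK gK), (transport gM' fM gK fK).
split=> [phi psi|phi|phi]; first exact: transportM.
  by apply: aut_ext => x /=; rewrite !fK.
by apply: aut_ext => x /=; rewrite !gK.
Qed.

Lemma out_card_gt_isomorphic (G H : Grp) N :
  isomorphic G H -> out_card_gt G N -> out_card_gt H N.
Proof.
move=> [f [g [fM fK gK]]] [phi phiP].
have gM : is_hom g by move=> x y; rewrite -{1}(gK x) -{1}(gK y) -fM fK.
exists (fun i => transport fM gM fK gK (phi i)) => i j n.
by rewrite -transportV -transportM => /inner_transport; apply: phiP.
Qed.

Lemma trivial_centre_isomorphic (G H : Grp) :
  isomorphic G H -> trivial_centre G -> trivial_centre H.
Proof.
move=> [f [g [fM fK gK]]] Z z zC.
rewrite -(gK z) (_ : g z = 1) ?(hom1 fM) //; apply: Z => x.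
apply: (inj_commute fM (can_inj fK)); rewrite /commute gK; exact: zC.
Qed.

(** * Extension to a direct product with an abelian group *)

Definition acts_trivially_on_characters (G : Grp) (theta : automorphism (Aut G)) :=
  forall (H : Grp) (chi : G -> H) (phi : automorphism G) a,
    (forall x y : H, commute x y) -> is_hom chi ->
    chi ((theta phi : automorphism G) a) = chi (phi a).

Section CentralExtension.
Variables Z A : Grp.
Hypotheses (Zab : forall x y : Z, commute x y) (A1 : trivial_centre A).
Local Notation G := (prodg Z A).
Implicit Types (phi psi : automorphism G) (z : Z) (a : A).

Definition bar_fun phi a : A := (phi (pin2 Z a)).2.

(** Elements of [Z] are central, hence so are their images; the second coordinate of such an image
    is central in [A], which is centreless. So [phi] induces a map on the quotient [A]. *)
Lemma aut_snd phi z a : (phi ((z, a) : G)).2 = bar_fun phi a.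
Proof.
rewrite (pin_mul ((z, a) : G)) afunM.
suff e : (phi (pin1 A z)).2 = 1.
  by rewrite -[LHS]/((phi (pin1 A z)).2 * bar_fun phi a) e gmul1.
apply: A1 => b.
have [q eq] : exists q, b = (phi q).2.
  by exists (ainv phi (pin2 Z b)); rewrite ainvK.
have C : commute (pin1 A z) q.
  case: q {eq} => z' a'; rewrite (pin_mul ((z', a') : G)); apply: commuteM.
    exact: (hom_commute (@pin1M _ _)).
  exact: pin_commute.
have := hom_commute (@is_hom_aut _ phi) C; rewrite eq.
exact: (congr1 snd).
Qed.

Lemma bar_fun_hom phi : is_hom (bar_fun phi).
Proof. by move=> a b; rewrite /bar_fun pin2M afunM. Qed.

Lemma bar_fun_comp phi psi a :
  bar_fun (aut_mul phi psi) a = bar_fun phi (bar_fun psi a).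
Proof.
rewrite {1}/bar_fun /= [psi _]surjective_pairing.
exact: aut_snd.
Qed.

Lemma bar_funK phi : cancel (bar_fun phi) (bar_fun (aut_inv phi)).
Proof. by move=> a; rewrite -bar_fun_comp /bar_fun /= afunK. Qed.

Lemma bar_funKV phi : cancel (bar_fun (aut_inv phi)) (bar_fun phi).
Proof. by move=> a; rewrite -bar_fun_comp /bar_fun /= ainvK. Qed.

Definition bar phi : Aut A :=
  Automorphism (@bar_fun_hom phi) (@bar_funK phi) (@bar_funKV phi).

Lemma barM phi psi : bar (aut_mul phi psi) = bar phi * bar psi.
Proof. by apply: aut_ext => a; exact: bar_fun_comp. Qed.

Lemma bar1 : bar (aut_one G) = 1.
Proof. exact: aut_ext. Qed.

Lemma barV phi : bar (aut_inv phi) = (bar phi)^-1.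
Proof.
apply: (@invg_uniq (Aut A)); rewrite -barM -bar1; congr bar.
exact: (@mulgV (Aut G)).
Qed.

Section Lift.
Variable theta : automorphism (Aut A).
Hypothesis thetaP : acts_trivially_on_characters theta.

Definition lift_fun phi (p : G) : G :=
  ((phi p).1, (theta (bar phi) : automorphism A) p.2).

Lemma lift_fun_hom phi : is_hom (lift_fun phi).
Proof.
move=> p q; rewrite /lift_fun afunM.
by rewrite -[(p * q).2]/(p.2 * q.2) (afunM (theta (bar phi) : automorphism A)).
Qed.

(** The second coordinates compose because [theta] and [bar] are homomorphisms. In the first, [phi]
    is evaluated at points whose [A]-parts differ by replacing [bar psi] with its image under
    [theta]; the [Z]-coordinate of [phi] on [A] is a character, so [thetaP] makes the values
    agree. *)
Lemma lift_fun_comp phi psi p :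
  lift_fun (aut_mul phi psi) p = lift_fun phi (lift_fun psi p).
Proof.
rewrite /lift_fun /= barM afunM /=; congr pair.
have E z a a' : (phi (pin2 Z a)).1 = (phi (pin2 Z a')).1 ->
    (phi ((z, a) : G)).1 = (phi ((z, a') : G)).1.
  rewrite (pin_mul ((z, a) : G)) (pin_mul ((z, a') : G)) !afunM => e.
  by congr gmul.
rewrite [psi p]surjective_pairing; apply: E.
have -> : (psi p).2 = bar_fun psi p.2 by case: p => z a; exact: aut_snd.
symmetry; apply: (thetaP (chi := fun a => (phi (pin2 Z a)).1)) => //.
by move=> a b; rewrite pin2M afunM.
Qed.

Lemma lift_fun1 p : lift_fun (aut_one G) p = p.
Proof.
rewrite /lift_fun /= bar1 (hom1 (@is_hom_aut _ theta)).
by case: p.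
Qed.

Lemma lift_funK phi : cancel (lift_fun phi) (lift_fun (aut_inv phi)).
Proof.
move=> p; rewrite -lift_fun_comp (_ : aut_mul _ _ = aut_one G) ?lift_fun1 //.
exact: (@gmulV (Aut G)).
Qed.

Lemma lift_funKV phi : cancel (lift_fun (aut_inv phi)) (lift_fun phi).
Proof.
move=> p; rewrite -lift_fun_comp (_ : aut_mul _ _ = aut_one G) ?lift_fun1 //.
exact: (@mulgV (Aut G)).
Qed.

Definition lift_aut phi : Aut G :=
  Automorphism (@lift_fun_hom phi) (@lift_funK phi) (@lift_funKV phi).

Lemma lift_aut_hom : is_hom (lift_aut : Aut G -> Aut G).
Proof. by move=> phi psi; apply: aut_ext => p; exact: lift_fun_comp. Qed.

Lemma bar_lift phi : bar (lift_aut phi) = theta (bar phi).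
Proof. exact: aut_ext. Qed.

End Lift.

Lemma characters_inv (theta : automorphism (Aut A)) :
  acts_trivially_on_characters theta -> acts_trivially_on_characters (aut_inv theta).
Proof.
move=> h H chi phi a Hab chiM.
by have /= := h H chi (ainv theta phi) a Hab chiM; rewrite ainvK => ->.
Qed.

Lemma lift_cancel (theta theta' : automorphism (Aut A))
    (h : acts_trivially_on_characters theta)
    (h' : acts_trivially_on_characters theta') :
  cancel theta theta' -> cancel (lift_aut h : Aut G -> Aut G) (lift_aut h').
Proof.
move=> K phi; apply: aut_ext => p.
rewrite /= {1}/lift_fun bar_lift K /=.
have -> : bar_fun phi p.2 = (phi p).2 by case: p => z a; rewrite aut_snd.
by rewrite -surjective_pairing.
Qed.

Definition lift (theta : automorphism (Aut A))
    (h : acts_trivially_on_characters theta) : automorphism (Aut G) :=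
  Automorphism (@lift_aut_hom theta h)
    (lift_cancel h (characters_inv h) (afunK theta))
    (lift_cancel (characters_inv h) h (ainvK theta)).

Lemma extend_hom (phi : automorphism A) : is_hom (fun p : G => (p.1, phi p.2) : G).
Proof. by move=> p q; congr pair; exact: afunM. Qed.

Lemma extendK (phi : automorphism A) :
  cancel (fun p : G => (p.1, phi p.2) : G) (fun p => (p.1, ainv phi p.2)).
Proof. by case=> z a; rewrite /= afunK. Qed.

Lemma extendKV (phi : automorphism A) :
  cancel (fun p : G => (p.1, ainv phi p.2) : G) (fun p => (p.1, phi p.2)).
Proof. by case=> z a; rewrite /= ainvK. Qed.

Definition extend (phi : automorphism A) : Aut G :=
  Automorphism (extend_hom phi) (extendK phi) (extendKV phi).

Lemma bar_extend (phi : automorphism A) : bar (extend phi) = phi.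
Proof. exact: aut_ext. Qed.

(** Evaluate the conjugation by [Phi] on automorphisms extended from [A] and apply [bar]: the result
    is conjugation by [bar Phi]. *)
Lemma inner_lift (theta theta' : automorphism (Aut A))
    (h : acts_trivially_on_characters theta)
    (h' : acts_trivially_on_characters theta') :
  inner (aut_mul (lift h) (aut_inv (lift h'))) -> inner (aut_mul theta (aut_inv theta')).
Proof.
move=> [Phi E]; exists (bar Phi) => phi.
have /= := congr1 bar (E (extend phi)); rewrite !bar_lift bar_extend /= => ->.
transitivity (bar (aut_mul Phi (aut_mul (extend phi) (aut_inv Phi)))) => //.
by rewrite !barM barV bar_extend.
Qed.

End CentralExtension.

(** * Verification of the hypotheses on the two free factors *)

Section DirectProductProperties.
Variables (G : Grp) (B : nat -> Grp) (k : nat).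
Variables (inj : forall i, B i -> G) (pr : forall i, G -> B i).
Hypothesis D : direct_decomposition k inj pr.
Hypothesis NA : forall i, nonabelian (B i).

Definition proj i (g : G) : G := inj (pr i g).

Lemma projM i : is_hom (proj i).
Proof. by move=> x y; rewrite /proj (prM D) (injM D). Qed.

Lemma proj_idem i g : (i < k)%N -> proj i (proj i g) = proj i g.
Proof. by move=> h; rewrite /proj (pr_inj D). Qed.

Lemma commute_inj_pr1 i (x : B i) g : pr i g = 1 -> commute (inj x) g.
Proof.
move=> e; apply: (commute_pr D) => j _; have [->|/eqP n] := eqVneq j i.
  by rewrite e; apply: commute1.
by rewrite (pr_inj1 D _ (nesym n)); apply/commute_sym/commute1.
Qed.

Lemma proj_copi i g h : (i < k)%N -> commute (proj i g) (copi (proj i) h).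
Proof.
move=> hi; apply: commute_inj_pr1.
by rewrite /copi (prM D) (homV (prM D i)) (pr_inj D) // gmulV.
Qed.

(** Take [x] in block 0 and [y] in block 1. Block 1 makes the centralizer of [x] non-abelian, and
    any [g] is its part outside block 0, which commutes with [x], times its part in block 0, which
    commutes with [y]. *)
Lemma direct_elliptic : (1 < k)%N -> elliptic_group G.
Proof.
move=> k1; have k0 : (0 < k)%N by apply: ltnW.
have [x0 n0] := nonabelian_nontrivial (NA 0).
have [y1 n1] := nonabelian_nontrivial (NA 1).
exists (inj x0), (inj y1); split; first split.
- by rewrite -(hom1 (injM D (i:=0%N))) => /(inj_injective D k0).
- by rewrite -(hom1 (injM D (i:=1%N))) => /(inj_injective D k1).
- by apply: (commute_inj D).
split.
  have [s [t n]] := NA 1; exists (inj s), (inj t); split.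
  - by apply: (commute_inj D).
  - by apply: (commute_inj D).
  - by move=> /(inj_commute (injM D (i:=1%N)) (inj_injective D k1)).
move=> g; exists (g * (proj 0 g)^-1), (proj 0 g); split.
- by rewrite mulgKV.
- apply: commute_inj_pr1.
  by rewrite (prM D) (homV (prM D 0)) (pr_inj D) // mulgV.
- by apply: commute_inj_pr1; apply: (pr_inj1 D).
Qed.

Lemma direct_trivial_centre :
  (forall i, commutative_transitive (B i)) -> trivial_centre G.
Proof.
move=> CT z zC; apply: (pr_ext D) => i hi; rewrite (pr1 D).
apply: (centralized_trivial (@CT i) (NA i)) => y.
by rewrite -[y](pr_inj D _ hi); apply: (pr_commute D); apply: zC.
Qed.

End DirectProductProperties.

(** A nontrivial element of [Z] serves as both [x] and [y]: its centralizer is everything, and is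
    non-abelian because of [G]. *)
Lemma elliptic_group_prodg (Z G : Grp) :
  (forall x y : Z, commute x y) -> (exists z : Z, z <> 1) -> nonabelian G ->
  elliptic_group (prodg Z G).
Proof.
move=> Zab [z nz] [s [t n]].
have zC p : commute (pin1 G z) p.
  rewrite (pin_mul p); apply: commuteM; last exact: pin_commute.
  exact: (hom_commute (@pin1M _ _)).
have nz' : pin1 G z <> 1 by case.
exists (pin1 G z), (pin1 G z); split; first by split.
split; first by exists (pin2 Z s), (pin2 Z t); split=> // -[].
by move=> g; exists g, 1; split; rewrite ?mulg1.
Qed.

Lemma prodg_centre (Z G : Grp) :
  (forall x y : Z, commute x y) -> (exists z : Z, z <> 1) ->
  ~ trivial_centre (prodg Z G).
Proof.
move=> Zab [z nz] H; have : pin1 G z = 1; last by case.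
apply: H => p; rewrite (pin_mul p); apply: commuteM; last exact: pin_commute.
exact: (hom_commute (@pin1M _ _)).
Qed.

(** * One involution of [Aut A] for each block *)

Section ManySwaps.
Variables (G1 G2 : Grp) (B : nat -> Grp) (k : nat).
Variables (inj : forall i, B i -> G1) (pr : forall i, G1 -> B i).
Hypothesis D : direct_decomposition k inj pr.
Hypothesis CT : forall i, commutative_transitive (B i).
Hypothesis NA : forall i, nonabelian (B i).
Hypothesis NI : forall i j, isomorphic (B i) (B j) -> i = j.
Hypothesis k_gt1 : (1 < k)%N.
Hypotheses (E2 : elliptic_group G2) (Z2 : ~ trivial_centre G2).

Local Notation A := (freeprod G1 G2).
Let E1 : elliptic_group G1 := direct_elliptic D NA k_gt1.
Let Z1 : trivial_centre G1 := direct_trivial_centre D NA CT.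
Local Notation e1 := (@in1 G1 G2).
Local Notation e2 := (@in2 G1 G2).

Lemma factor_restriction1 (psi : automorphism A) : preserves_factors psi ->
  exists f : automorphism G1, forall x, psi (e1 x) = e1 (f x).
Proof.
move=> H.
have X (phi : automorphism A) : preserves_factors phi ->
    exists f : G1 -> G1, forall x, phi (e1 x) = e1 (f x).
  move=> h; suff F x : exists y, phi (e1 x) = e1 y.
    by exists (fun x => sval (cid (F x))) => x; case: cid.
  by apply: in1P; rewrite h; apply: inF_in1.
have [f fP] := X _ H.
have [|g gP] := X (aut_inv psi).
  by move=> b a; rewrite -(H b) /= ainvK.
have fM : is_hom f.
  by move=> x y; apply: (@in1_inj _ G2); rewrite in1_hom -!fP -afunM -in1_hom.
have fK : cancel f g.
  by move=> x; apply: (@in1_inj _ G2); have /= <- := gP (f x); rewrite -fP afunK.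
have gK : cancel g f.
  by move=> x; apply: (@in1_inj _ G2); rewrite -[LHS]fP; have /= <- := gP x; rewrite ainvK.
by exists (Automorphism fM fK gK).
Qed.

Lemma preserves_adapted (psi : automorphism A) i :
  (i < k)%N -> preserves_factors psi -> adapted e1 e2 (proj inj pr i) psi.
Proof.
move=> hi H; have [f fP] := factor_restriction1 H.
have F y : exists z, psi (e2 y) = e2 z.
  by apply: in2P; rewrite H; apply: inF_in2.
exists f, (fun y => sval (cid (F y))); split=> //.
- exact: is_hom_aut.
- by move=> y; case: cid.
- by move=> x; apply: (aut_projection D CT NA NI).
Qed.

Lemma adapted_exists i (hi : (i < k)%N) (phi : automorphism A) :
  exists c psi, adapted e1 e2 (proj inj pr i) psi /\ phi = aut_mul (ad c) psi.
Proof.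
have [c [psi [h ->]]] := aut_decomposition E1 E2 Z1 Z2 phi.
by exists c, psi; split=> //; apply: preserves_adapted.
Qed.

(** Conjugation by [c'^-1 * c] carries a nontrivial element of each factor into the same factor, so
    by malnormality [c'^-1 * c] lies in both factors. *)
Lemma adapted_unique i c c' (psi psi' : automorphism A) :
  adapted e1 e2 (proj inj pr i) psi -> adapted e1 e2 (proj inj pr i) psi' ->
  aut_mul (ad c) psi = aut_mul (ad c') psi' -> c = c'.
Proof.
move=> [f1 [f2 [_ h1 h2 _]]] [f1' [f2' [_ h1' h2' _]]] e.
have E a : conjg (c'^-1 * c) (psi a) = psi' a.
  rewrite conjMg; have /= -> := congr1 (fun phi : automorphism A => phi a) e.
  by rewrite conjgK.
apply: (@mulgI _ c'^-1); rewrite gmulV; apply: inF_both.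
  have [x nx] := elliptic_group_neq1 E1.
  have n : psi (e1 x) <> 1.
    rewrite -(hom1 (@is_hom_aut _ psi)) => /aut_inj.
    by rewrite -(hom1 (@in1_hom G1 G2)) => /in1_inj.
  have hx : inF true (psi (e1 x)) by rewrite h1; apply: inF_in1.
  have hx' : inF true (conjg (c'^-1 * c) (psi (e1 x))).
    by rewrite E h1'; apply: inF_in1.
  by have [] := malnormal hx n hx'.
have [x nx] := elliptic_group_neq1 E2.
have n : psi (e2 x) <> 1.
  rewrite -(hom1 (@is_hom_aut _ psi)) => /aut_inj.
  by rewrite -(hom1 (@in2_hom G1 G2)) => /in2_inj.
have hx : inF false (psi (e2 x)) by rewrite h2; apply: inF_in2.
have hx' : inF false (conjg (c'^-1 * c) (psi (e2 x))).
  by rewrite E h2'; apply: inF_in2.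
by have [] := malnormal hx n hx'.
Qed.

Definition factor_swap i (hi : (i < k)%N) : automorphism (Aut A) :=
  swap (freeprod_coproduct G1 G2) (projM D i) (fun g => proj_idem D g hi)
    (fun g h => proj_copi D g h hi) (adapted_exists hi) (@adapted_unique i).

Lemma factor_swap_characters i (hi : (i < k)%N) :
  acts_trivially_on_characters (factor_swap hi).
Proof. by move=> H chi phi a Hab chiM; apply: swap_abelian. Qed.

(** Test on conjugation by a nontrivial [b] of block [i]. The [j]-th swap fixes it, so if the
    quotient were conjugation by [Phi], the [i]-th swap would send it to conjugation by [Phi b]. But
    this image is trivial on the first free factor, whose centralizer is trivial, so [Phi b = 1]. *)
Lemma factor_swap_not_inner i j (hi : (i < k)%N) (hj : (j < k)%N) : i <> j ->
  ~ inner (aut_mul (factor_swap hi) (aut_inv (factor_swap hj))).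
Proof.
move=> nij [Phi E]; have [x nx] := nonabelian_nontrivial (NA i).
set b := in1 G2 (inj x).
have fixed : factor_swap hj (ad b) = ad b.
  by apply: swap_ad_fixed; rewrite /proj (pr_inj1 D _ nij) (hom1 (injM D (i:=j))).
have {E}E : factor_swap hi (ad b) = ad ((Phi : automorphism A) b).
  have e0 : ainv (factor_swap hj) (ad b) = ad b by rewrite -{1}fixed afunK.
  have := E (ad b).
  rewrite -[LHS]/(factor_swap hi (ainv (factor_swap hj) (ad b))) e0 => ->.
  apply: aut_ext => a.
  change (Phi (conjg b (ainv Phi a)) = conjg (Phi b) a).
  by rewrite (hom_conjg (@is_hom_aut _ Phi)) ainvK.
have b1 : (Phi : automorphism A) b = 1.
  apply: (centralizer_factor1 E1 E2 Z1) => y; apply: fix_conjg.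
  rewrite -[LHS]/((ad _ : automorphism A) _) -E.
  by apply: swap_ad_e1; rewrite /proj (pr_inj D).
apply: nx; apply: (inj_injective D hi); apply: (@in1_inj _ G2).
rewrite (hom1 (injM D (i:=i))) (hom1 (@in1_hom _ _)) -/b.
by apply: (@aut_inj _ Phi); rewrite b1 (hom1 (@is_hom_aut _ Phi)).
Qed.

End ManySwaps.

(** * The groups of the theorem *)

Section Example.
Variable N : nat.

Definition example_block (i : nat) : Grp := freeg i.+2.
(** The theorem asks for [N + 1] involutions; one block more keeps at least two blocks when [N] is
    0, as [direct_elliptic] demands. Ranks start at 2 so that every block is nonabelian. *)
Definition example_group : Grp :=
  freeprod (prodn example_block N.+2) (prodg intg (freeg 2)).

Lemma example_block_uniq i j :
  isomorphic (example_block i) (example_block j) -> i = j.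
Proof.
by move=> h; have [] := is_raag_uniq (is_raag_freeg i.+2) (is_raag_freeg j.+2) h.
Qed.

Lemma intg_nontrivial : exists z : intg, z <> 1.
Proof. exact: is_raag_nontrivial is_raag_intg. Qed.

Lemma example_swaps : exists phi : 'I_N.+1 -> automorphism (Aut example_group),
  (forall i, acts_trivially_on_characters (phi i)) /\
  (forall i j, i != j -> ~ inner (aut_mul (phi i) (aut_inv (phi j)))).
Proof.
have D := prodn_direct example_block N.+2.
have CT i : commutative_transitive (example_block i).
  exact: freeg_commutative_transitive.
have NA i : nonabelian (example_block i) by exact: freeg_nonabelian.
have E2 := elliptic_group_prodg intg_commute intg_nontrivial (freeg_nonabelian 0).
have Z2 := prodg_centre (G := freeg 2) intg_commute intg_nontrivial.
have lt_k (i : 'I_N.+1) : (i < N.+2)%N by apply: ltnW; rewrite ltnS.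
exists (fun i => factor_swap D CT NA example_block_uniq (isT : (1 < N.+2)%N) E2 Z2 (lt_k i)).
split=> [i|i j n]; first exact: factor_swap_characters.
by apply: factor_swap_not_inner => e; case/eqP: n; apply: val_inj.
Qed.

Lemma example_out : out_card_gt (Aut example_group) N.
Proof. by have [phi [_ h]] := example_swaps; exists phi. Qed.

Lemma example_trivial_centre : trivial_centre example_group.
Proof.
have D := prodn_direct example_block N.+2.
have CT i : commutative_transitive (example_block i).
  exact: freeg_commutative_transitive.
have NA i : nonabelian (example_block i) by exact: freeg_nonabelian.
have E2 := elliptic_group_prodg intg_commute intg_nontrivial (freeg_nonabelian 0).
exact: (freeprod_trivial_centre (direct_elliptic D NA isT) E2
          (direct_trivial_centre D NA CT)).
Qed.

Lemma central_example_out : out_card_gt (Aut (prodg intg example_group)) N.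
Proof.
have [phi [h n]] := example_swaps.
exists (fun i => lift intg_commute example_trivial_centre (h i)) => i j nij.
by move=> /inner_lift; apply: n.
Qed.

Lemma example_is_raag : exists n, is_raag n example_group.
Proof.
have [|n hn] := @is_raag_prodn example_block N.+2.
  by move=> i; exists i.+2; apply: is_raag_freeg.
exists (n + (1 + 2))%N; apply: (is_raag_freeprod hn).
exact: (is_raag_prodg is_raag_intg (is_raag_freeg 2)).
Qed.

Lemma central_example_is_raag : exists n, is_raag n (prodg intg example_group).
Proof.
have [n hn] := example_is_raag.
by exists (1 + n)%N; apply: (is_raag_prodg is_raag_intg).
Qed.

End Example.

Theorem theoremA :
  (forall N : nat, exists (n : nat) (e : rel 'I_n),
     simplicial e /\ out_card_gt (Aut (raag e)) N) /\
  (forall N : nat, exists (n : nat) (e : rel 'I_n),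
     simplicial e /\ out_card_gt (Aut (raag e)) N /\ trivial_centre (raag e)) /\
  (forall N : nat, exists (n : nat) (e : rel 'I_n),
     simplicial e /\ out_card_gt (Aut (raag e)) N /\ ~ trivial_centre (raag e)).
Proof.
have centreless N : exists (n : nat) (e : rel 'I_n),
    simplicial e /\ out_card_gt (Aut (raag e)) N /\ trivial_centre (raag e).
  have [n /is_raag_raag[e [se i]]] := example_is_raag N.
  have i' := isomorphic_sym i.
  exists n, e; split=> //; split.
    exact: out_card_gt_isomorphic (isomorphic_Aut i') (example_out N).
  exact: trivial_centre_isomorphic i' (example_trivial_centre (N := N)).
split; last split=> // N.
  by move=> N; have [n [e [se [h _]]]] := centreless N; exists n, e.
have [n /is_raag_raag[e [se i]]] := central_example_is_raag N.
exists n, e; split=> //; split.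
  exact: out_card_gt_isomorphic (isomorphic_Aut (isomorphic_sym i)) (central_example_out N).
move=> /(trivial_centre_isomorphic i).
exact: (prodg_centre intg_commute intg_nontrivial).
Qed.
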